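(* Let $p\in[1,2)$. For any $U\in\mathbb U^p$, the sequence $\{M^{U,n}\}_{n\in\mathbb N}$ of square-integrable martingales $$M^{U,n}_t:=\int_{(0,t]}\int_{\mathcal X}\mathbf 1_{\{|U_s(x)|\le n\}}U_s(x)\,\widetilde N_{\mathfrak p}(ds,dx),\qquad t\in[0,T],$$ is a Cauchy sequence in $(\mathbb M^1,\|\cdot\|_{\mathbb M^1})$, whose limit $M^U$ is a càdlàg uniformly integrable martingale with quadratic variation $$[M^U,M^U]_t=\int_{(0,t]}\int_{\mathcal X}|U_s(x)|^2\,N_{\mathfrak p}(ds,dx),\qquad t\in[0,T].$$ The jump process of $M^U$ satisfies, for $P$-a.s. $\omega\in\Omega$, $$\Delta M^U_t(\omega)=\mathbf 1_{\{t\in D_{\mathfrak p(\omega)}\}}U\big(t,\omega,\mathfrak p_t(\omega)\big),\qquad\forall\,t\in(0,T].$$ Moreover, $U\mapsto M^U$ is a linear mapping on $\mathbb U^p$.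
   Context: **Setting.** Fix $T\in(0,\infty)$, $l,d\in\mathbb N$, and a complete probability space $(\Omega,\mathcal F,P)$ carrying a $d$-dimensional Brownian motion $B$. Let $(\mathcal X,\mathcal F_{\mathcal X})$ be a measurable space and $\mathfrak p$ an $\mathcal X$-valued Poisson point process independent of $B$; for each $\omega$, $D_{\mathfrak p(\omega)}\subset(0,T]$ denotes the countable set of jump times of the path $\mathfrak p(\omega)$, and $\mathfrak p_t(\omega)\in\mathcal X$ its value at $t\in D_{\mathfrak p(\omega)}$. The counting measure $N_{\mathfrak p}(dt,dx)$ of $\mathfrak p$ on $[0,T]\times\mathcal X$ has compensator $\nu(dx)\,dt$ for a finite measure $\nu$ on $(\mathcal X,\mathcal F_{\mathcal X})$; $\widetilde N_{\mathfrak p}(dt,dx)=N_{\mathfrak p}(dt,dx)-\nu(dx)dt$. $\mathbf F=\{\mathcal F_t\}_{t\in[0,T]}$ is the filtration generated by $B$ and $N_{\mathfrak p}$, augmented by all $P$-null sets; $\widehat{\mathscr P}$ is the $\mathbf F$-predictable $\sigma$-field on $[0,T]\times\Omega$. $\mathbb U^p$ is the space of $\widehat{\mathscr P}\otimes\mathcal F_{\mathcal X}$-measurable random fields $U:[0,T]\times\Omega\times\mathcal X\to\mathbb R^l$ with $E\int_0^T\int_{\mathcal X}|U_t(x)|^p\nu(dx)dt<\infty$. $\mathbb M^1$ is the space of all càdlàg local martingales $M=\{M_t\}_{t\in[0,T]}$ with $\|M\|_{\mathbb M^1}:=E\{[M,M]_T^{1/2}\}<\infty$; this norm is equivalent to $M\mapsto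 E[\sup_{t\in[0,T]}|M_t|]$, and $(\mathbb M^1,\|\cdot\|_{\mathbb M^1})$ is a Banach space. For a càdlàg process $X$, $\Delta X_t:=X_t-X_{t-}$ with $X_{0-}:=X_0$. Since $E\int_0^T\int_{\mathcal X}\mathbf 1_{\{|U_s(x)|\le n\}}|U_s(x)|^2\nu(dx)ds\le n^{2-p}E\int_0^T\int_{\mathcal X}|U_s(x)|^p\nu(dx)ds<\infty$, each $M^{U,n}$ is a well-defined classical $L^2$ Poisson stochastic integral. *)

(* Defs.v *)
From HB Require Import structures.
From mathcomp Require Import all_boot all_order all_algebra.
From mathcomp Require Import all_classical all_reals all_analysis.
From mathcomp Require Import measurable_realfun.

Set Implicit Arguments.
Unset Strict Implicit.
Unset Printing Implicit Defensive.

Import Order.TTheory GRing.Theory Num.Theory.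
Import numFieldNormedType.Exports.

Local Open Scope classical_set_scope.
Local Open Scope ring_scope.

(* The norm `|x| of the library on 'rV[R]_l is the sup norm; the Euclidean
   norm is needed here. *)
Definition enorm2 (R : realType) (l : nat) (x : 'rV[R]_l) : R :=
  \sum_(i < l) x 0 i ^+ 2.

Definition enorm (R : realType) (l : nat) (x : 'rV[R]_l) : R :=
  Num.sqrt (enorm2 x).

Definition cadlag_path (R : realType) (V : ptopologicalType) (T : R)
    (f : R -> V) : Prop :=
  (forall t, 0 <= t < T -> f s @[s --> t^'+] --> f t) /\
  (forall t, 0 < t <= T -> cvg (f s @[s --> t^'-])).

Definition left_lim (R : realType) (l : nat) (f : R -> 'rV[R]_l) (t : R) :
    'rV[R]_l :=
  if t <= 0 then f 0 else lim (f s @[s --> t^'-]).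

Definition path_jump (R : realType) (l : nat) (f : R -> 'rV[R]_l) (t : R) :
    'rV[R]_l :=
  f t - left_lim f t.

Definition mesh (R : realType) (s : seq R) : R :=
  \big[Num.max/0]_(k < size s) (nth 0 s k - nth 0 (0 :: s) k).

Section Probability.
Context {R : realType} {dO : measure_display} {Omega : measurableType dO}.
Variable P : probability Omega R.

Definition component (l : nat) (X : R -> Omega -> 'rV[R]_l) (i : 'I_l) :
    R -> Omega -> R :=
  fun t omega => X t omega 0 i.

Definition measurable_wrt (dV : measure_display) (V : measurableType dV)
    (G : set (set Omega)) (Y : Omega -> V) : Prop :=
  forall C : set V, measurable C -> G (Y @^-1` C).

Definition mutually_independent (dV : measure_display) (V : measurableType dV)
    (I : finType) (Y : I -> Omega -> V) : Prop :=
  forall C : I -> set V, (forall i, measurable (C i)) ->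
    P (\bigcap_i (Y i @^-1` C i)) = (\prod_(i in I) P (Y i @^-1` C i))%E.

Definition independent_families (G H : set (set Omega)) : Prop :=
  forall A C, G A -> H C -> P (A `&` C) = (P A * P C)%E.

Definition indistinguishable (T : R) (l : nat)
    (X Y : R -> Omega -> 'rV[R]_l) : Prop :=
  {ae P, forall omega, forall t, 0 <= t <= T -> X t omega = Y t omega}.

Definition brownian_motion (T : R) (d : nat) (B : R -> Omega -> 'rV[R]_d) :
    Prop :=
  [/\ forall t i, 0 <= t <= T -> measurable_fun setT (component B i t),
      {ae P, forall omega, B 0 omega = 0},
      {ae P, forall omega, {within `[0, T], continuous (fun t => B t omega)}},
      forall s t i C, 0 <= s < t -> t <= T -> measurable C ->
        P [set omega | C (component B i t omega - component B i s omega)] =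
        normal_prob 0 (Num.sqrt (t - s)) C &
      forall (n : nat) (t : nat -> R), 0 <= t 0%N -> t n <= T ->
        (forall k, (k < n)%N -> t k < t k.+1) ->
        mutually_independent (fun (ki : 'I_n * 'I_d) omega =>
          component B ki.2 (t ki.1.+1) omega - component B ki.2 (t ki.1) omega)].

(* A point process is encoded by partial functions of time:
   [pp omega t = Some x] means that the path [pp omega] has a point at time
   [t], with value [x]. *)
Section PointProcess.
Context {dX : measure_display} {X : measurableType dX}.
Variable pp : Omega -> R -> option X.

Definition jump_times (omega : Omega) : set R :=
  [set t | exists x, pp omega t = Some x].

Definition count_measure (omega : Omega) (C : set (R * X)) : \bar R :=
  counting [set t | exists2 x, pp omega t = Some x & C (t, x)].

Definition point_process (T : R) : Prop :=
  (forall omega, countable (jump_times omega) /\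
     jump_times omega `<=` `]0, T]) /\
  (forall C : set (R * X), measurable C ->
     measurable_fun setT (fun omega => count_measure omega C)).

(* The Poisson weights are spelled out because the library's [poisson_pmf] is
   constantly 1 at rate 0. *)
Definition poisson_point_process (T : R) : Prop :=
  [/\ point_process T,
      forall C : set (R * X), measurable C ->
        let m := (\int[P]_omega count_measure omega C)%E in
        if m == +oo%E then
          {ae P, forall omega, count_measure omega C = +oo%E}
        else forall k : nat,
          P [set omega | count_measure omega C = k%:R%:E] =
          (expR (- fine m) * fine m ^+ k / k`!%:R)%:E &
      forall (n : nat) (C : 'I_n -> set (R * X)),
        (forall i, measurable (C i)) -> trivIset setT C ->
        mutually_independent (fun i omega => count_measure omega (C i))].

Definition at_jump (V : zmodType) (f : R -> Omega -> X -> V) (t : R)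
    (omega : Omega) : V :=
  if pp omega t is Some x then f t omega x else 0.

(* Integral of a field over (0, t] x X against the counting measure of [pp],
   i.e. the sum over the points of [pp]. The sum is meaningful when [pp omega]
   has finitely many points in (0, t], which holds almost surely when the
   compensator is finite; its value elsewhere is irrelevant. *)
Definition count_integral (V : zmodType) (f : R -> Omega -> X -> V) (t : R)
    (omega : Omega) : V :=
  \sum_(s \in jump_times omega `&` `]0, t]) at_jump f s omega.

(* Stochastic integral against the compensated measure for integrands that are
   integrable with respect to nu(dx)dt. *)
Definition compensated_integral (nu : {finite_measure set X -> \bar R})
    (l : nat) (f : R -> Omega -> X -> 'rV[R]_l) (t : R) (omega : Omega) :
    'rV[R]_l :=
  count_integral f t omega -
  \row_i \int[lebesgue_measure]_(s in `]0, t]) \int[nu]_x f s omega x 0 i.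

End PointProcess.

Section Filtration.
Context {dX : measure_display} {X : measurableType dX}.
Variables (T : R) (d : nat) (B : R -> Omega -> 'rV[R]_d).
Variable pp : Omega -> R -> option X.

Definition brownian_sigma : set (set Omega) :=
  <<s [set A | exists s i C, [/\ 0 <= s <= T, measurable C &
                                 A = component B i s @^-1` C]] >>.

Definition point_process_sigma : set (set Omega) :=
  <<s [set A | exists (E : set (R * X)) (C : set (\bar R)),
         [/\ measurable E, measurable C &
             A = (fun omega => count_measure pp omega E) @^-1` C]] >>.

Definition filtration (t : R) : set (set Omega) :=
  <<s [set A | exists s i C, [/\ 0 <= s <= t, measurable C &
                                 A = component B i s @^-1` C]] `|`
      [set A | exists s (E : set X) (C : set (\bar R)),
         [/\ 0 <= s <= t, measurable E, measurable C &
             A = (fun omega => count_measure pp omega (`]0, s] `*` E)) @^-1` C]]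
      `|` P.-negligible >>.

End Filtration.

Section Processes.
Variables (T : R) (F : R -> set (set Omega)).

Definition adapted (X : R -> Omega -> R) : Prop :=
  forall t, 0 <= t <= T -> measurable_wrt (F t) (X t).

Definition rmartingale (X : R -> Omega -> R) : Prop :=
  [/\ adapted X,
      forall t, 0 <= t <= T -> P.-integrable setT (EFin \o X t) &
      forall s t A, 0 <= s <= t -> t <= T -> F s A ->
        (\int[P]_(omega in A) (X t omega)%:E =
         \int[P]_(omega in A) (X s omega)%:E)%E].

Definition martingale (l : nat) (X : R -> Omega -> 'rV[R]_l) : Prop :=
  forall i, rmartingale (component X i).

Definition cadlag (l : nat) (X : R -> Omega -> 'rV[R]_l) : Prop :=
  {ae P, forall omega, cadlag_path T (fun t => X t omega)}.

Definition square_integrable_martingale (l : nat)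
    (X : R -> Omega -> 'rV[R]_l) : Prop :=
  [/\ cadlag X, martingale X &
      forall t, 0 <= t <= T ->
        (\int[P]_omega (enorm2 (X t omega))%:E < +oo)%E].

Definition uniformly_integrable (l : nat) (X : R -> Omega -> 'rV[R]_l) : Prop :=
  ereal_sup [set (\int[P]_(omega in [set omega | (c < enorm (X t omega))%R])
                     (enorm (X t omega))%:E)%E | t in `[0, T]]
    @[c --> +oo%R] --> 0%E.

Definition stopping_time (tau : Omega -> R) : Prop :=
  (forall omega, 0 <= tau omega <= T) /\
  (forall t, 0 <= t <= T -> F t [set omega | tau omega <= t]).

Definition stopped (l : nat) (X : R -> Omega -> 'rV[R]_l) (tau : Omega -> R) :
    R -> Omega -> 'rV[R]_l :=
  fun t omega => X (Num.min t (tau omega)) omega.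

Definition local_martingale (l : nat) (X : R -> Omega -> 'rV[R]_l) : Prop :=
  exists tau : nat -> Omega -> R,
    [/\ forall k, stopping_time (tau k),
        forall k omega, tau k omega <= tau k.+1 omega,
        {ae P, forall omega, exists k, tau k omega = T} &
        forall k, martingale (stopped X (tau k))].

Definition square_sum (l : nat) (X : R -> Omega -> 'rV[R]_l) (s : seq R)
    (omega : Omega) : R :=
  enorm2 (X 0 omega) +
  \sum_(k < size s) enorm2 (X (nth 0 s k) omega - X (nth 0 (0 :: s) k) omega).

(* [A] is a version of [X, X]: the cadlag nondecreasing adapted process whose
   value at t is the limit in probability of the sums of squared increments
   along partitions of [0, t] whose mesh tends to 0. The convention is
   [X, X]_0 = |X_0|^2, and [X, X] is the sum over i of [X^i, X^i]. *)
Definition is_quadratic_variation (l : nat) (X : R -> Omega -> 'rV[R]_l)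
    (A : R -> Omega -> R) : Prop :=
  [/\ adapted A,
      {ae P, forall omega, cadlag_path T (fun t => A t omega)},
      {ae P, forall omega, forall s t, 0 <= s <= t -> t <= T ->
        A s omega <= A t omega} &
      forall t (pi : nat -> seq R), 0 <= t <= T ->
        (forall k, itv_partition 0 t (pi k)) ->
        mesh (pi k) @[k --> \oo] --> 0 ->
        forall eta, 0 < eta ->
          P [set omega | eta < `|square_sum X (pi k) omega - A t omega|]
            @[k --> \oo] --> 0%E].

(* A choice of version; versions are indistinguishable from each other. *)
Definition quadratic_variation (l : nat) (X : R -> Omega -> 'rV[R]_l) :
    R -> Omega -> R :=
  xget (fun _ _ => 0) [set A | is_quadratic_variation X A].

(* The value +oo excludes processes without quadratic variation, for which
   [quadratic_variation] is a default value. *)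
Definition M1norm (l : nat) (X : R -> Omega -> 'rV[R]_l) : \bar R :=
  if `[< exists A, is_quadratic_variation X A >]
  then (\int[P]_omega (Num.sqrt (quadratic_variation X T omega))%:E)%E
  else +oo%E.

Definition in_M1 (l : nat) (X : R -> Omega -> 'rV[R]_l) : Prop :=
  [/\ cadlag X, local_martingale X & (M1norm X < +oo)%E].

Definition M1dist (l : nat) (X Y : R -> Omega -> 'rV[R]_l) : \bar R :=
  M1norm (fun t omega => X t omega - Y t omega).

Definition M1_cauchy (l : nat) (X : nat -> R -> Omega -> 'rV[R]_l) : Prop :=
  (forall n, in_M1 (X n)) /\
  (forall eps : R, 0 < eps -> exists n0 : nat, forall m n : nat,
     (n0 <= m)%N -> (n0 <= n)%N -> (M1dist (X m) (X n) < eps%:E)%E).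

Definition M1_converges (l : nat) (X : nat -> R -> Omega -> 'rV[R]_l)
    (Y : R -> Omega -> 'rV[R]_l) : Prop :=
  in_M1 Y /\ M1dist (X n) Y @[n --> \oo] --> 0%E.

Definition predictable_sigma : set (set (R * Omega)) :=
  <<s `[0, T] `*` setT,
      [set C | (exists2 A, F 0 A & C = [set 0] `*` A) \/
               (exists s t A, [/\ 0 <= s, s < t, t <= T, F s A &
                                  C = `]s, t] `*` A])] >>.

Context {dX : measure_display} {X : measurableType dX}.

(* Integrability is required separately because [fine +oo%E] is 0. *)
Definition compensator (pp : Omega -> R -> option X)
    (nu : {finite_measure set X -> \bar R}) : Prop :=
  forall E : set X, measurable E ->
    (\int[P]_omega count_measure pp omega (`]0%R, T] `*` E) < +oo)%E /\
    rmartingale (fun t omega =>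
      fine (count_measure pp omega (`]0, t] `*` E)) - t * fine (nu E)).

Definition predictable_product_sigma : set (set (R * Omega * X)) :=
  <<s (`[0, T] `*` setT) `*` setT,
      [set C `*` E | C in predictable_sigma & E in measurable] >>.

Definition predictable_field (l : nat) (U : R -> Omega -> X -> 'rV[R]_l) :
    Prop :=
  forall (i : 'I_l) (C : set R), measurable C ->
    predictable_product_sigma
      ((`[0, T] `*` setT) `*` setT `&`
       [set z | C (U z.1.1 z.1.2 z.2 0 i)]).

Definition in_Up (nu : {finite_measure set X -> \bar R}) (p : R) (l : nat)
    (U : R -> Omega -> X -> 'rV[R]_l) : Prop :=
  predictable_field U /\
  (\int[P]_omega \int[lebesgue_measure]_(t in `[0%R, T]) \int[nu]_x
     (enorm (U t omega x) `^ p)%:E < +oo)%E.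

End Processes.

Definition truncate (X : Type) (l : nat) (n : nat)
    (U : R -> Omega -> X -> 'rV[R]_l) : R -> Omega -> X -> 'rV[R]_l :=
  fun t omega x => if enorm (U t omega x) <= n%:R then U t omega x else 0.

End Probability.

(* Main.v *)
(* For p >= 1 and a finite nu, a field U in U^p is integrable for P(d omega) nu(dx) dt,
   so M^U can be taken to be the path by path integral: the finite sum of U over the
   points minus the Lebesgue integral of its nu-mean. The martingale property of the
   compensated counts extends, by a pi-lambda argument on predictable rectangles, to
   the compensation formula E sum g = E int g dnu dt for predictable g; applied to g
   times the indicator of ]s, t] x A this gives the martingale property of M^U. On
   almost every path M^U is a finite step function minus a continuous function of
   bounded variation, so its jumps are those of the sum and the sums of squared
   increments converge to the sum of |U|^2. Hence
     ||M^U|| = E (sum |U|^2)^(1/2) <= E sum |U| = E int |U| dnu dt,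
   and M^{U,m} - M^{U,n}, being the integral of a field dominated by |U| 1_{|U| > k}
   for k <= m, n, has norm tending to 0 by dominated convergence. *)

Require Import Defs.
From HB Require Import structures.
From mathcomp Require Import all_boot all_order all_algebra.
From mathcomp Require Import all_classical all_reals all_analysis.
From mathcomp Require Import measurable_realfun finmap ring lra.

Set Implicit Arguments.
Unset Strict Implicit.
Unset Printing Implicit Defensive.

Import Order.TTheory GRing.Theory Num.Theory.
Import numFieldNormedType.Exports.

Local Open Scope classical_set_scope.
Local Open Scope ring_scope.

(** * Random discrete measures and mixtures *)

Section dirac_seq.
Local Open Scope ereal_scope.
Context d (Z : measurableType d) (R : realType).

(** For fixed omega, the sum over the points and the drift are both read as integrals against
    measures on the predictable space R x Omega x X carried by the section at omega. The dependence
    on omega then sits in a kernel, so that measurability, adaptedness at time t and the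
    compensation formula only have to be checked on rectangles ]u, v] x A x E with A in F u.
    Finiteness of the set of points, and hence most identities between paths, hold only off null
    sets; the augmentation of the filtration lets adaptedness survive such modifications.
    [quadratic_variation] is an arbitrary choice of version, so bounding [M1norm] requires
    uniqueness of limits in probability along an explicit sequence of partitions. Integrability of U
    comes from |x| <= 1 + |x|^p and the finiteness of dP dt dnu. Square integrability of M^{U,n}
    comes from an almost sure bound of |M^{U,n}| by a constant times 1 + N, where the number of
    points N has a Poisson law. *)

Fixpoint dirac_seq (s : seq Z) : {measure set Z -> \bar R} :=
  if s is z :: s' then measure_add (dirac z) (dirac_seq s') else mzero.

Lemma dirac_seqE s A : dirac_seq s A = \sum_(z <- s) \d_z A.
Proof.
elim: s => [|z s ih]; first by rewrite big_nil.
by rewrite big_cons -ih; exact: measure_addE.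
Qed.

Lemma ge0_integral_dirac_seq s (f : Z -> \bar R) : (forall z, 0 <= f z) ->
  measurable_fun setT f -> \int[dirac_seq s]_z f z = \sum_(z <- s) f z.
Proof.
move=> f0 mf; elim: s => [|z s ih].
  by rewrite big_nil integral_measure_zero.
rewrite big_cons ge0_integral_measure_add//= ih integral_dirac//.
by rewrite diracT mul1e.
Qed.

Lemma integral_dirac_seq s (f : Z -> R) : measurable_fun setT f ->
  \int[dirac_seq s]_z (f z)%:E = (\sum_(z <- s) f z)%:E.
Proof.
move=> mf; have mEf : measurable_fun setT (EFin \o f) by exact/measurable_EFinP.
rewrite integralE !ge0_integral_dirac_seq//;
  [|exact: measurable_funeneg|exact: measurable_funepos].
rewrite (eq_bigr (fun z => (f^\+ z)%:E))//.
rewrite [X in _ - X](eq_bigr (fun z => (f^\- z)%:E))//.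
  rewrite !sumEFin -EFinB -sumrB; congr EFin.
  by apply: eq_bigr => z _; rewrite -[f in RHS]funrposBneg.
- by move=> z _; rewrite funenegE -EFinN -EFin_max.
- by move=> z _; rewrite funeposE -EFin_max.
Qed.
End dirac_seq.
Arguments dirac_seq {d Z} R s.

Section mixture.
Local Open Scope ereal_scope.
Context dY dZ (Y : measurableType dY) (Z : measurableType dZ) (R : realType).
Variables (P : {measure set Y -> \bar R}) (k : Y -> {measure set Z -> \bar R}).

(** The second marginal of the measure P(dy) k(y, dz). The measurability proof is a parameter so
    that the measure structure below can be attached to the term. *)
Definition mixture (mk : forall U, measurable U -> measurable_fun setT (k ^~ U))
    (U : set Z) : \bar R :=
  \int[P]_y k y U.

Variable mk : forall U, measurable U -> measurable_fun setT (k ^~ U).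

Let mixture0 : mixture mk set0 = 0.
Proof. by apply: integral0_eq => y _; rewrite measure0. Qed.

Let mixture_ge0 U : 0 <= mixture mk U.
Proof. by apply: integral_ge0 => y _; exact: measure_ge0. Qed.

Let mixture_semi_sigma_additive : semi_sigma_additive (mixture mk).
Proof.
move=> F mF tF mUF; rewrite [X in _ --> X](_ : _ =
    \int[P]_y \sum_(n <oo) k y (F n)); last first.
  apply: eq_integral => y _; apply/esym/cvg_lim => //.
  exact: measure_semi_sigma_additive.
rewrite [X in _ --> X]integral_nneseries//; last by move=> n; exact: mk.
apply: is_cvg_nneseries => n _ _; exact: mixture_ge0.
Qed.

HB.instance Definition _ := isMeasure.Build _ _ _ (mixture mk)
  mixture0 mixture_ge0 mixture_semi_sigma_additive.

Import HBNNSimple.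

Let integral_mixture_nnsfun (f : {nnsfun Z >-> R}) :
  \int[mixture mk]_z (f z)%:E = \int[P]_y \int[k y]_z (f z)%:E.
Proof.
have E (m : {measure set Z -> \bar R}) : \int[m]_z (f z)%:E =
    \sum_(x \in range f) x%:E * m (f @^-1` [set x]).
  by rewrite integralT_nnsfun sintegralE.
rewrite E; under [RHS]eq_integral do rewrite E.
rewrite ge0_integral_fsum//; last 2 first.
- by move=> r; apply: measurable_funeM; exact: mk.
- by move=> r y _; exact: nnsfun_mulemu_ge0.
(* A negative r has empty preimage under a nonnegative simple function, so both sides vanish. *)
apply: eq_fsbigr => r _; have [r0|r0] := leP 0%R r.
  by rewrite ge0_integralZl//; exact: mk.
rewrite integral0_eq => [|y _]; rewrite preimage_nnfun0// measure0 ?mule0//.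
Qed.

Lemma ge0_integral_mixture (f : Z -> \bar R) : (forall z, 0 <= f z) ->
  measurable_fun setT f ->
  \int[mixture mk]_z f z = \int[P]_y \int[k y]_z f z.
Proof.
move=> f0 mf; pose f_ := nnsfun_approx measurableT mf.
have mf_ n : measurable_fun setT (fun z => (f_ n z)%:E) by exact/measurable_EFinP.
have f_0 n z : 0 <= (f_ n z)%:E by rewrite lee_fin.
have nd_f_ z : {homo (fun n => (f_ n z)%:E) : m n / (m <= n)%N >-> m <= n}.
  by move=> a b ab; rewrite lee_fin; exact/lefP/nd_nnsfun_approx.
have E (m : {measure set Z -> \bar R}) :
    \int[m]_z f z = lim (\int[m]_z (f_ n z)%:E @[n --> \oo]).
  rewrite -monotone_convergence//; apply: eq_integral => z _.
  by apply/esym/cvg_lim => //; exact: cvg_nnsfun_approx.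
rewrite E; under eq_fun do rewrite integral_mixture_nnsfun.
rewrite -monotone_convergence//.
- by apply: eq_integral => y _; rewrite -E.
- by move=> n; apply: measurable_fun_integral_kernel.
- by move=> n y _; exact: integral_ge0.
- by move=> y _ a b ab; apply: ge0_le_integral => // z _; exact: nd_f_.
Qed.

Variables (f : Z -> \bar R).
Hypothesis fint : (mixture mk).-integrable setT f.

Let mf : measurable_fun setT f. Proof. exact: measurable_int fint. Qed.

Let measurable_integral_abs :
  measurable_fun setT (fun y => \int[k y]_z `|f z|).
Proof. by apply: measurable_fun_integral_kernel => //; exact: measurableT_comp. Qed.

(** The P-average of the integrals of |f| is finite, so almost all of them are finite. *)
Lemma ae_integrable_mixture : {ae P, forall y, (k y).-integrable setT f}.
Proof.
have : P.-integrable setT (fun y => \int[k y]_z `|f z|).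
  apply/integrableP; split => //.
  under eq_integral do rewrite gee0_abs ?integral_ge0//.
  rewrite -ge0_integral_mixture//; last exact: measurableT_comp.
  by case/integrableP : fint.
move=> /integrable_ae => /(_ measurableT); apply: filterS => y /(_ I) fy.
by apply/integrableP; split=> //; move: fy; rewrite fin_num_abs gee0_abs ?integral_ge0.
Qed.

Let integrable_mixture_aux (g : Z -> \bar R) : measurable_fun setT g ->
  (forall z, 0 <= g z <= `|f z|) -> P.-integrable setT (fun y => \int[k y]_z g z).
Proof.
move=> mg g0; have g0' z : 0 <= g z by case/andP: (g0 z).
apply/integrableP; split; first exact: measurable_fun_integral_kernel.
under eq_integral do rewrite gee0_abs ?integral_ge0//.
rewrite -ge0_integral_mixture//.
case/integrableP : fint => _; apply: le_lt_trans.
apply: ge0_le_integral => //; first exact: measurableT_comp.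
by move=> z _; case/andP: (g0 z).
Qed.

Lemma integrable_mixture : P.-integrable setT (fun y => \int[k y]_z f z).
Proof.
under eq_fun do rewrite integralE.
apply: integrableB => //; apply: integrable_mixture_aux.
- exact: measurable_funepos.
- by move=> z; rewrite funepos_ge0/= -[leRHS]/((abse \o f) z) fune_abse leeDl// funeneg_ge0.
- exact: measurable_funeneg.
- by move=> z; rewrite funeneg_ge0/= -[leRHS]/((abse \o f) z) fune_abse leeDr// funepos_ge0.
Qed.

Lemma integral_mixture : \int[mixture mk]_z f z = \int[P]_y \int[k y]_z f z.
Proof.
rewrite [LHS]integralE.
transitivity (\int[P]_y (\int[k y]_z f^\+ z - \int[k y]_z f^\- z)); last first.
  by apply: eq_integral => y _; rewrite [RHS]integralE.
rewrite integralB//.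
- by rewrite !ge0_integral_mixture//; [exact: measurable_funeneg|exact: measurable_funepos].
- apply: integrable_mixture_aux; first exact: measurable_funepos.
  by move=> z; rewrite funepos_ge0/= -[leRHS]/((abse \o f) z) fune_abse leeDl// funeneg_ge0.
- apply: integrable_mixture_aux; first exact: measurable_funeneg.
  by move=> z; rewrite funeneg_ge0/= -[leRHS]/((abse \o f) z) fune_abse leeDr// funepos_ge0.
Qed.

End mixture.

(** * The filtration and the points of the process *)

Section Filtration.
Context {R : realType} {dO dX : measure_display} {Omega : measurableType dO}
  {X : measurableType dX} (P : probability Omega R) (d : nat) (T : R)
  (B : R -> Omega -> 'rV[R]_d) (pp : Omega -> R -> option X).

Local Notation F := (filtration P B pp).

Lemma filtration_sub s t : s <= t -> F s `<=` F t.
Proof.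
move=> st; apply: sub_sigma_algebra2 => A [[|]|]; last by right.
- move=> [u [i [C [/andP[u0 us] mC ->]]]]; left; left.
  by exists u, i, C; split => //; rewrite u0 (le_trans us st).
- move=> [u [E [C [/andP[u0 us] mE mC ->]]]]; left; right.
  by exists u, E, C; split => //; rewrite u0 (le_trans us st).
Qed.

Lemma filtration_sigma_algebra t : sigma_algebra setT (F t).
Proof. exact: smallest_sigma_algebra. Qed.

Lemma filtration_negligible t : P.-negligible `<=` F t.
Proof. by move=> N PN; apply: sub_sigma_algebra; right. Qed.

Lemma filtration_measurable t : measure_is_complete P ->
  (forall s i, 0 <= s <= T -> measurable_fun setT (component B i s)) ->
  (forall C : set (R * X), measurable C ->
     measurable_fun setT (fun omega => count_measure pp omega C)) ->
  t <= T -> F t `<=` measurable.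
Proof.
move=> cP mB mpp tT; apply: smallest_sub; first exact: sigma_algebra_measurable.
move=> A [[|]|/cP//].
- move=> [u [i [C [/andP[u0 ut] mC ->]]]]; rewrite -[_ @^-1` _]setTI.
  by apply: mB => //; rewrite u0 (le_trans ut).
- move=> [u [E [C [/andP[u0 ut] mE mC ->]]]]; rewrite -[_ @^-1` _]setTI.
  by apply: mpp => //; apply: measurableX.
Qed.

Lemma filtration_count s t E : 0 <= s <= t -> measurable E ->
  measurable_wrt (F t) (fun omega => count_measure pp omega (`]0, s] `*` E)).
Proof.
move=> st mE C mC; apply: sub_sigma_algebra; left; right.
by exists s, E, C.
Qed.

(** Omega with F t as its measurable structure: measurability with respect to F t becomes ordinary
    measurability, and the usual closure properties apply to it. *)
Definition filteredType (t : R) := g_sigma_algebraType (F t).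
HB.instance Definition _ t := Measurable.on (filteredType t).

Lemma measurable_filteredE t : @measurable _ (filteredType t) = F t.
Proof. exact/sigma_algebra_id/filtration_sigma_algebra. Qed.

Lemma filtrationI t A A' : F t A -> F t A' -> F t (A `&` A').
Proof. by rewrite -measurable_filteredE => ? ?; exact: measurableI. Qed.

Lemma filtrationT t : F t setT.
Proof. by rewrite -measurable_filteredE; exact: measurableT. Qed.

Lemma filtrationC t A : F t A -> F t (~` A).
Proof. by rewrite -measurable_filteredE; exact: measurableC. Qed.

Lemma filtrationU t A A' : F t A -> F t A' -> F t (A `|` A').
Proof. by rewrite -measurable_filteredE => ? ?; exact: measurableU. Qed.

Lemma measurable_wrtP t dV (V : measurableType dV) (Y : Omega -> V) :
  measurable_wrt (F t) Y <-> measurable_fun setT (Y : filteredType t -> V).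
Proof.
have E := measurable_filteredE t; split=> mY.
- by move=> _ C mC; rewrite setTI E; exact: mY.
- by move=> C mC; rewrite -E -[_ @^-1` _]setTI; exact: mY.
Qed.

(** The augmentation at work: the preimages under Y and Y' differ only inside a negligible set, and
    every subset of a negligible set is negligible, hence in F t. *)
Lemma ae_measurable_wrt t dV (V : measurableType dV) (Y Y' : Omega -> V) :
  {ae P, forall omega, Y omega = Y' omega} ->
  measurable_wrt (F t) Y -> measurable_wrt (F t) Y'.
Proof.
move=> YY' mY C mC; set N := ~` [set w | Y w = Y' w] in YY'.
have Nt : F t N by exact: filtration_negligible.
have -> : Y' @^-1` C = ~` (~` (Y @^-1` C) `|` N) `|` (Y' @^-1` C `&` N).
  apply/seteqP; split => w /=.
    move=> Cw; have [YYw|YYw] := pselect (Y w = Y' w); last by right.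
    by left=> -[|/(_ YYw)//]; rewrite YYw.
  move=> [/not_orP[/contrapT Yw /contrapT YY]|[]//].
  by rewrite -YY.
apply: filtrationU.
  by apply: filtrationC; apply: filtrationU => //; apply: filtrationC; exact: mY.
apply: filtration_negligible.
by apply: negligibleS YY' => w [].
Qed.

End Filtration.

Section Points.
Context {R : realType} {dO dX : measure_display} {Omega : measurableType dO}
  {X : measurableType dX} (T : R) (pp : Omega -> R -> option X).

Local Notation mR := (measurableTypeR R).

(* Empty when there are infinitely many jump times: [fset_set] is then [fset0]. *)
Definition points (omega : Omega) : seq (mR * X)%type :=
  pmap (fun s => omap (pair s) (pp omega s)) (fset_set (jump_times pp omega)).

Lemma big_points (V : zmodType) omega (Q : pred R) (f : R -> X -> V) :
  \sum_(z <- points omega | Q z.1) f z.1 z.2 =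
  \sum_(s <- fset_set (jump_times pp omega) | Q s)
    (if pp omega s is Some x then f s x else 0).
Proof.
rewrite /points; elim: (finmap.enum_fset _) => [|s r ih]; first by rewrite !big_nil.
rewrite big_cons /=; case: (pp omega s) => [x|] /=.
  by rewrite big_cons /= ih.
by rewrite ih; case: ifP => // _; rewrite add0r.
Qed.

Lemma fst_pointsE omega (z : mR * X) : z \in points omega ->
  z.1 \in fset_set (jump_times pp omega).
Proof.
rewrite mem_pmap => /mapP[s sJ]; case: (pp omega s) => //= x [->].
exact: sJ.
Qed.

Lemma points_gt0 (omega : Omega) (z : mR * X) : jump_times pp omega `<=` `]0, T] ->
  z \in points omega -> 0 < z.1 <= T.
Proof.
move=> JT /fst_pointsE.
have [Jf|Jf] := pselect (finite_set (jump_times pp omega)).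
  by rewrite in_fset_set// => /set_mem/JT; rewrite /= in_itv.
(* With infinitely many jump times the list is empty. *)
by rewrite /fset_set; case: pselect => // _; rewrite in_fset0.
Qed.

Definition points_upto (t : R) (omega : Omega) : seq (mR * X)%type :=
  [seq z <- points omega | z.1 <= t].

Lemma count_integralE (V : zmodType) (f : R -> Omega -> X -> V) t omega :
  finite_set (jump_times pp omega) -> jump_times pp omega `<=` `]0, T] ->
  count_integral pp f t omega = \sum_(z <- points_upto t omega) f z.1 omega z.2.
Proof.
move=> Jf JT; rewrite /points_upto big_filter.
rewrite (big_points _ (fun s => s <= t) (fun s x => f s omega x)) /count_integral.
rewrite fsbig_mkcondr fsbig_finite// [RHS]big_mkcond/=.
rewrite big_seq [RHS]big_seq; apply: eq_bigr => s.
rewrite in_fset_set// => /set_mem/JT; rewrite /= in_itv/= => /andP[s0 sT].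
rewrite /at_jump; congr (if _ then _ else _).
by rewrite mem_setE in_itv/= s0.
Qed.

Definition point_measure (omega : Omega) : {measure set (mR * X) -> \bar R} :=
  dirac_seq R (points omega).

Lemma count_measureE C omega : finite_set (jump_times pp omega) ->
  count_measure pp omega C = point_measure omega C.
Proof.
move=> Jf; rewrite /point_measure dirac_seqE /count_measure /counting.
set D := [set t | _].
have DJ : D `<=` jump_times pp omega by move=> t [x ptx _]; exists x.
have Df : finite_set D by exact: sub_finite_set Jf.
pose g (s : R) (x : X) : R := \1_C (s, x).
rewrite [RHS](_ : _ = (\sum_(z <- points omega | predT z.1) g z.1 z.2)%:E); last first.
  by rewrite -sumEFin; apply: eq_bigr => -[].
rewrite asboolT// big_points -sum1_size natr_sum.
rewrite -(fsbig_finite _ _ Jf) -(fsbig_finite _ _ Df).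
rewrite (eq_fsbigr (fun s => if pp omega s is Some x then g s x else 0)).
  congr EFin; apply: fsbig_widen => // s [Js Ds] /=.
  case E : (pp omega s) => [x|//]; rewrite /g indicE memNset// => Cs.
  by apply: Ds; exists x.
by move=> s /set_mem[x -> Cs]; rewrite /g indicE mem_set.
Qed.

End Points.

(** * Finiteness of the set of points and counts over half-open intervals *)

Section Kernels.
Context {R : realType} {dO dX : measure_display} {Omega : measurableType dO}
  {X : measurableType dX} (P : probability Omega R) (d : nat) (T : R)
  (B : R -> Omega -> 'rV[R]_d) (pp : Omega -> R -> option X)
  (nu : {finite_measure set X -> \bar R}).

Local Notation F := (filtration P B pp).

Hypothesis hpt : point_process pp T.
Hypothesis hF : forall t, t <= T -> F t `<=` measurable.
Hypothesis hnu : compensator P T F pp nu.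

Let jumpsT omega : jump_times pp omega `<=` `]0, T].
Proof. by have [] := hpt.1 omega. Qed.

(** The compensator condition makes the expected count over ]0, T] x X finite, and [counting] is +oo
    on infinite sets. *)
Lemma ae_finite_jumps : {ae P, forall omega, finite_set (jump_times pp omega)}.
Proof.
have [+ _] := hnu measurableT.
pose C : set (R * X) := `]0, T] `*` setT; rewrite -/C; move=> Cfin.
have mC : measurable_fun setT (fun omega => count_measure pp omega C).
  by apply: hpt.2; apply: measurableX.
have : P.-integrable setT (fun omega => count_measure pp omega C).
  apply/integrableP; split => //.
  by under eq_integral do rewrite gee0_abs ?measure_ge0//.
move=> /integrable_ae -/(_ measurableT); apply: filterS => omega /(_ I).
rewrite /count_measure /counting; case: ifPn => // /asboolP Df _.
by apply: sub_finite_set Df => t /[dup] /jumpsT tT [x ptx]; exists x.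
Qed.

Lemma ae_count_measureE : {ae P, forall omega, forall C,
  count_measure pp omega C = point_measure pp omega C}.
Proof. by apply: filterS ae_finite_jumps => omega Jf C; exact: count_measureE. Qed.

Lemma dirac_seq_fin_num dZ (Z : measurableType dZ) (s : seq Z) (A : set Z) :
  dirac_seq R s A \is a fin_num.
Proof. by rewrite dirac_seqE sumEFin. Qed.

Lemma count_itv u w E omega : 0 <= u <= w -> measurable E ->
  point_measure pp omega (`]u, w] `*` E) =
  (point_measure pp omega (`]0%R, w] `*` E) -
   point_measure pp omega (`]0%R, u] `*` E))%E.
Proof.
move=> /andP[u0 uw] mE.
have -> : `]0%R, w] `*` E = (`]0%R, u] `*` E) `|` (`]u, w] `*` E).
  apply/seteqP; split => -[s x] /=; rewrite !in_itv/=.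
    move=> [/andP[s0 sw] Ex]; have [su|us] := leP s u; [left|right];
    by rewrite ?s0 ?us.
  move=> [[/andP[s0 su] Ex]|[/andP[us sw] Ex]]; split => //.
    by rewrite s0 (le_trans su).
  by rewrite (le_lt_trans u0 us).
rewrite measureU//; first by rewrite addeAC subee ?add0e// dirac_seq_fin_num.
- exact: measurableX.
- exact: measurableX.
- rewrite -setXI; apply/seteqP; split => // -[s x] [/= + _].
  by rewrite !in_itv/= => -[/andP[_ su] /andP[us _]]; rewrite ltNge su in us.
Qed.

(** The generators of the filtration count points over ]0, s] x E, so the count over ]u, w] is a
    difference of two of them. [point_measure] agrees with [count_measure] only almost surely, which
    the augmentation absorbs. *)
Lemma count_wrt t u w E : 0 <= u -> w <= t -> measurable E ->
  measurable_wrt (F t) (fun omega => point_measure pp omega (`]u, w] `*` E)).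
Proof.
move=> u0 wt mE; have [uw|wu] := leP u w; last first.
  rewrite (_ : (fun _ => _) = cst 0%E).
    by apply/measurable_wrtP; exact: measurable_cst.
  by apply/funext => omega; rewrite set_itv_ge ?bnd_simp -?leNgt 1?ltW// set0X measure0.
have mc s : 0 <= s <= t -> measurable_wrt (F t) (fun omega => point_measure pp omega (`]0, s] `*` E)).
  move=> st; apply: (@ae_measurable_wrt _ _ _ _ _ P d B pp t _ _ (fun omega => count_measure pp omega (`]0, s] `*` E))).
    by apply: filterS ae_count_measureE => omega ->.
  exact: filtration_count.
have := mc w; rewrite (le_trans u0 uw) wt => /(_ isT)/measurable_wrtP m1.
have := mc u; rewrite u0 (le_trans uw wt) => /(_ isT)/measurable_wrtP m2.
apply/measurable_wrtP; under eq_fun do rewrite (count_itv _ _ mE) ?u0//.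
exact: emeasurable_funB.
Qed.

Lemma measurable_point_measure u w E : 0 <= u -> w <= T -> measurable E ->
  measurable_fun setT (fun omega => point_measure pp omega (`]u, w] `*` E)).
Proof.
move=> u0 wT mE _ C mC; rewrite setTI.
by apply: (hF (lexx T)); apply: count_wrt.
Qed.

(** This is the martingale property of the compensated count between u and w, tested on A in F u,
    with the deterministic compensator moved to the right. *)
Lemma expectation_point_measure u w A E : 0 <= u <= T -> w <= T -> F u A ->
  measurable E ->
  (\int[P]_(omega in A) point_measure pp omega (`]u, w] `*` E) =
   P A * (lebesgue_measure `]u, w] * nu E))%E.
Proof.
move=> /andP[u0 uT] wT FA mE; have [wu|uw] := leP w u.
  rewrite set_itv_ge ?bnd_simp -?leNgt// measure0 mul0e mule0.
  by apply: integral0_eq => omega _; rewrite set0X measure0.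
have mA : measurable A by exact: hF FA.
have [_ [ad int mart]] := hnu mE.
pose c s omega := fine (count_measure pp omega (`]0, s] `*` E)).
have intc s : 0 <= s <= T -> P.-integrable setT (EFin \o c s).
  move=> /int ints.
  have -> : EFin \o c s = ((EFin \o (fun omega =>
      (c s omega - s * fine (nu E))%R)) \+ cst (s * fine (nu E))%:E)%E.
    by apply/funext => omega /=; rewrite -EFinD subrK.
  by apply: integrableD => //; exact: finite_measure_integrable_cst.
have intcA s : 0 <= s <= T -> P.-integrable A (EFin \o c s).
  by move=> /intc; apply: integrableS.
have iA r : P.-integrable A (EFin \o cst r).
  exact: finite_measure_integrable_cst.
have E1 s : 0 <= s <= T ->
    (\int[P]_(omega in A) (c s omega - s * fine (nu E))%:E =
    \int[P]_(omega in A) (c s omega)%:E - (s * fine (nu E))%:E * P A)%E.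
  move=> sT; under eq_integral do rewrite EFinB.
  by rewrite integralB//; [rewrite integral_cst|exact: intcA|exact: (iA _)].
have := mart u w A; rewrite u0 (ltW uw) => /(_ isT wT FA).
rewrite E1 ?(le_trans u0 (ltW uw))// E1 ?u0// => E2.
transitivity (\int[P]_(omega in A) ((c w omega)%:E - (c u omega)%:E))%E.
  apply: ae_eq_integral => //.
  - by apply: measurable_funTS; exact: measurable_point_measure.
  - apply: emeasurable_funB; [apply: (measurable_int P); apply: intcA..].
      by rewrite wT (le_trans u0 (ltW uw)).
    by rewrite u0.
  apply: filterS ae_count_measureE => omega cE _.
  rewrite count_itv// ?u0 ?ltW// /c !cE !fineK//; exact: dirac_seq_fin_num.
rewrite integralB//; [|apply: intcA; rewrite wT (le_trans u0 (ltW uw))//|apply: intcA; rewrite u0//].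
have fw : (\int[P]_(omega in A) (c w omega)%:E)%E \is a fin_num.
  by apply: (integrable_fin_num mA); apply: intcA; rewrite wT (le_trans u0 (ltW uw)).
have fu : (\int[P]_(omega in A) (c u omega)%:E)%E \is a fin_num.
  by apply: (integrable_fin_num mA); apply: intcA; rewrite u0.
have fPA : P A \is a fin_num by exact: fin_num_measure.
have fnuE : nu E \is a fin_num by exact: fin_num_measure.
rewrite lebesgue_measure_itv/= lte_fin uw -EFinB.
have solve (x y a n : \bar R) : x \is a fin_num -> y \is a fin_num ->
    a \is a fin_num -> n \is a fin_num ->
    (x - (w * fine n)%:E * a = y - (u * fine n)%:E * a ->
     x - y = a * ((w - u)%:E * n))%E.
  move: x y a n => [x| |] [y| |] [a| |] [n| |]// _ _ _ _.
  rewrite -!EFinM -!EFinB => -[/eqP]; rewrite subr_eq => /eqP ->; congr EFin.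
  by rewrite /=; ring.
exact: solve fw fu fPA fnuE E2.
Qed.

End Kernels.

(** * Predictable space and compensation formula *)

Section PredictableSpace.
Context {R : realType} {dO dX : measure_display} {Omega : measurableType dO}
  {X : measurableType dX} (P : probability Omega R) (d : nat) (T : R)
  (B : R -> Omega -> 'rV[R]_d) (pp : Omega -> R -> option X).

Local Notation F := (filtration P B pp).
Local Notation mR := (measurableTypeR R).

(* Rectangles over the time 0 are left out: it carries neither points nor Lebesgue
   mass, and every field is cut off outside ]0, T] below. *)
Definition predictable_rectangle : set (set (R * Omega * X)) :=
  [set setT] `|` [set D | exists u v A E, [/\ 0 <= u <= T, v <= T, F u A,
     measurable E & D = (`]u, v] `*` A) `*` E]].

Lemma predictable_rectangle_setI : setI_closed predictable_rectangle.
Proof.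
move=> C D [-> PD|]; first by rewrite setTI.
move=> [u [v [A [E [/andP[u0 uT] vT FA mE CE]]]]] [->|].
  by rewrite setIT; right; exists u, v, A, E; rewrite u0 uT.
move=> [u' [v' [A' [E' [/andP[u0' uT'] vT' FA' mE' DE]]]]].
right; exists (Num.max u u'), (Num.min v v'), (A `&` A'), (E `&` E'); split.
- by rewrite le_max u0/= ge_max uT.
- by rewrite ge_min vT.
- apply: filtrationI; first by apply: filtration_sub FA; rewrite le_max lexx.
  by apply: filtration_sub FA'; rewrite le_max lexx orbT.
- exact: measurableI.
rewrite {}CE {}DE; apply/seteqP; split => -[[s w] x] /=; rewrite !in_itv/=.
  move=> [[[/andP[us sv] Aw] Ex] [[/andP[us' sv'] Aw'] Ex']].
  by rewrite gt_max us us' le_min sv sv'.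
rewrite gt_max le_min => -[[/andP[/andP[us us'] /andP[sv sv']] [Aw Aw']] [Ex Ex']].
by rewrite us us' sv sv'.
Qed.

(** On this type the coordinates of a predictable field, cut off outside ]0, T], are measurable
    functions. Composition with [mark omega] below restricts them to a path. *)
Definition predictableType := g_sigma_algebraType predictable_rectangle.
HB.instance Definition _ := Measurable.on predictableType.

Definition mark (omega : Omega) (z : mR * X) : predictableType :=
  ((z.1, omega), z.2).

Lemma mark_rectangle omega u v A E :
  mark omega @^-1` ((`]u, v] `*` A) `*` E) =
  if omega \in A then `]u, v] `*` E else set0.
Proof.
apply/seteqP; split => -[s x] /=.
  by move=> [[sv Aw] Ex]; rewrite mem_set.
by case: ifPn => // /set_mem Aw [sv Ex].
Qed.

Lemma measurable_mark omega : measurable_fun setT (mark omega).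
Proof.
apply: (@measurability _ _ _ _ setT (mark omega) predictable_rectangle) => //.
move=> _ [_ [->|[u [v [A [E [_ _ _ mE ->]]]]]] <-]; first by rewrite setTI preimage_setT.
rewrite setTI mark_rectangle; case: ifP => // _.
exact: measurableX.
Qed.

HB.instance Definition _ omega :=
  isMeasurableFun.Build _ _ _ _ (mark omega) (measurable_mark omega).

Lemma measurable_rectangle u v A E : 0 <= u <= T -> v <= T -> F u A ->
  measurable E ->
  measurable ((`]u, v] `*` A) `*` E : set predictableType).
Proof.
move=> uT vT FA mE; apply: sub_gen_smallest; right.
by exists u, v, A, E.
Qed.

Hypothesis hT : 0 < T.

Let S : set predictableType := (`]0, T] `*` setT) `*` setT.

Let mS : measurable S.
Proof. by apply: measurable_rectangle; rewrite ?lexx ?ltW//; exact: filtrationT. Qed.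

(** The sets C with measurable trace on [S] form a sigma-algebra on [0, T] x Omega. A generator over
    the time 0 has empty trace, and a generator over ]s, t] yields one of the rectangles. *)
Lemma predictable_sigma_measurable (C : set (R * Omega)) E :
  predictable_sigma T F C -> measurable E ->
  measurable (((C `*` E) `&` S) : set predictableType).
Proof.
move=> + mE.
pose K := [set C : set (R * Omega) | measurable (((C `*` E) `&` S) : set predictableType)].
suff : predictable_sigma T F `<=` K by move=> /[apply].
have mSE : measurable ((`]0, T] `*` setT) `*` E : set predictableType).
  by apply: measurable_rectangle; rewrite ?lexx ?ltW//; exact: filtrationT.
apply: smallest_sub.
- split.
  + by rewrite /K/= set0X set0I.
  + move=> A; rewrite /K/= => mA.
    have -> : ((`[0, T] `*` [set: Omega]) `\` A) `*` E `&` S =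
        ((`]0, T] `*` setT) `*` E) `\` (A `*` E `&` S).
      apply/seteqP; split => -[[s w] x]; rewrite /S/= !in_itv/=.
        move=> [[[[sT _] nA] Ex] [[/andP[s0 sT'] _] _]]; rewrite s0 sT'; split => //.
        by move=> [[]].
      move=> [[[/andP[s0 sT] _] Ex] nA]; rewrite s0 (ltW s0) sT; split => //.
      by split => //; split => // Aw; apply: nA; rewrite s0 sT.
    exact: measurableD.
  + move=> A mA; rewrite /K/=.
    have -> : (\bigcup_k A k) `*` E `&` S = \bigcup_k (A k `*` E `&` S).
      apply/seteqP; split => -[[s w] x] /=.
        by move=> [[[k _ Ak] Ex] Sx]; exists k.
      by move=> [k _ [[Ak Ex] Sx]]; split => //; split => //; exists k.
    exact: bigcupT_measurable.
- move=> _ [[A FA ->]|[s [t [A [s0 st tT FA ->]]]]]; rewrite /K/=.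
    rewrite (_ : _ `&` _ = set0)//; apply/seteqP; split => // -[[s w] x]; rewrite /S/=.
    by rewrite in_itv/= => -[[[-> _] _] [[]]]; rewrite ltxx.
  rewrite (_ : _ `&` _ = (`]s, t] `*` A) `*` E).
    by apply: measurable_rectangle => //; rewrite s0 ltW// (lt_le_trans st).
  apply/seteqP; split => -[[r w] x]; rewrite /S/=; first by case.
  rewrite !in_itv/= => -[[/andP[sr rt] Aw] Ex]; split => //.
    by rewrite sr rt.
  by rewrite (le_lt_trans s0 sr) (le_trans rt tT).
Qed.

Lemma predictable_product_measurable (D : set (R * Omega * X)) :
  predictable_product_sigma T F D ->
  measurable ((D `&` S) : set predictableType).
Proof.
pose K := [set D : set (R * Omega * X) | measurable ((D `&` S) : set predictableType)].
apply: (@smallest_sub _ _ _ K).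
- split.
  + by rewrite /K/= set0I.
  + move=> A; rewrite /K/= => mA.
    have -> : (`[0, T] `*` [set: Omega] `*` [set: X] `\` A) `&` S =
        S `\` (A `&` S).
      apply/seteqP; split => -[[s w] x]; rewrite /S/= !in_itv/=.
        by move=> [[[[sT _] _] nA] [[s0 _] _]]; split => // -[].
      move=> [[[/andP[s0 sT] _] _] nA]; rewrite s0 (ltW s0) sT; split => //.
      by split => // Aw; apply: nA; rewrite s0 sT.
    exact: measurableD.
  + move=> A mA; rewrite /K/= setI_bigcupl.
    exact: bigcupT_measurable.
- by move=> _ [C pC [E mE <-]]; exact: predictable_sigma_measurable.
Qed.

Lemma predictable_field_measurable l (U : R -> Omega -> X -> 'rV[R]_l) i :
  predictable_field T F U ->
  measurable_fun S (fun z : predictableType => U z.1.1 z.1.2 z.2 0 i).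
Proof.
move=> pU _ C mC; have := predictable_product_measurable (pU i C mC).
congr measurable; apply/seteqP; split => -[[s w] x] /=; rewrite /S/= !in_itv/=.
  by move=> [[_ Cw] sT].
by move=> [[[/andP[s0 sT] _] _] Cw]; rewrite s0 (ltW s0) sT.
Qed.

End PredictableSpace.

(** * Jump and drift kernels, and equality of their mixtures *)

Section KernelsOnPredictable.
Context {R : realType} {dO dX : measure_display} {Omega : measurableType dO}
  {X : measurableType dX} (P : probability Omega R) (d : nat) (T : R)
  (B : R -> Omega -> 'rV[R]_d) (pp : Omega -> R -> option X)
  (nu : {finite_measure set X -> \bar R}).

Local Notation F := (filtration P B pp).
Local Notation mR := (measurableTypeR R).
Local Notation PP := (predictableType P T B pp).
Local Notation mark := (@mark _ _ _ _ _ P _ T B pp).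

Hypothesis hT : 0 < T.
Hypothesis hpt : point_process pp T.
Hypothesis hF : forall t, t <= T -> F t `<=` measurable.
Hypothesis hnu : compensator P T F pp nu.

(* [jump_kernel] and [drift_kernel] live on the section at [omega] of the predictable
   space; their mixtures over P are the Doleans measures of the counting measure and
   of its compensator. *)
Definition jump_kernel (t : R) (omega : Omega) : {measure set PP -> \bar R} :=
  dirac_seq R (map (mark omega) (points_upto pp t omega)).

Lemma measurable_strip (t : R) :
  measurable (`]0, t] `*` setT : set (mR * X)%type).
Proof. exact: measurableX. Qed.

Definition strip_measure (t : R) : {measure set (mR * X)%type -> \bar R} :=
  mrestr (lebesgue_measure \x nu)%E (measurable_strip t).

Lemma measurable_dirac_mark omega (U : set PP) : measurable U ->
  measurable_fun setT (fun z => @dirac _ PP (mark omega z) R U).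
Proof.
move=> mU; apply/measurable_EFinP.
have m1 : measurable_fun setT (\1_U : PP -> R) by exact: measurable_indic.
exact: measurableT_comp m1 (@measurable_mark _ _ _ _ _ P d T B pp omega).
Qed.

(** The image of [strip_measure t] under [mark omega], written as a mixture of Dirac masses so that
    integrals against it are given by [ge0_integral_mixture]. *)
Definition drift_kernel (t : R) (omega : Omega) : {measure set PP -> \bar R} :=
  mixture (strip_measure t) (measurable_dirac_mark omega).

Lemma drift_kernelE t omega U : measurable U ->
  drift_kernel t omega U = strip_measure t (mark omega @^-1` U).
Proof.
move=> mU; rewrite /drift_kernel /= /mixture.
have mV : measurable (mark omega @^-1` U).
  by rewrite -[_ @^-1` _]setTI; exact: measurable_mark.
have <- : (\int[strip_measure t]_z (\1_(mark omega @^-1` U) z)%:E =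
    strip_measure t (mark omega @^-1` U))%E.
  by rewrite integral_indic ?setIT.
by apply: eq_integral => z _.
Qed.

Lemma jump_kernel_rectangle t omega u v A E :
  jump_kernel t omega ((`]u, v] `*` A) `*` E) =
  if omega \in A then point_measure pp omega (`]u, Num.min v t] `*` E) else 0%E.
Proof.
rewrite /jump_kernel /point_measure !dirac_seqE big_map big_filter.
case: ifPn => Aw; last first.
  rewrite big1// => -[s x] _; rewrite diracE memNset// => -[[_ /=]].
  by move=> /mem_set; rewrite (negbTE Aw).
rewrite big_mkcond/=; apply: eq_bigr => -[s x] _ /=; rewrite !diracE.
case: ifPn => st.
  congr ((nat_of_bool _)%:R%:E); apply/idP/idP => /set_mem/= h; apply/mem_set => /=.
    by move: h => [[+ _] Ex]; rewrite !in_itv/= le_min st andbT.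
  move: h => [+ Ex]; rewrite !in_itv/= le_min st andbT => h.
  by split => //; split => //; exact/set_mem.
rewrite memNset// => -[/=]; rewrite in_itv/= le_min (negbTE st) andbF.
by rewrite andbF.
Qed.

Lemma drift_kernel_rectangle t omega u v A E : 0 <= u <= T -> v <= T ->
  F u A -> measurable E ->
  drift_kernel t omega ((`]u, v] `*` A) `*` E) =
  if omega \in A then (lebesgue_measure `]u, Num.min v t] * nu E)%E else 0%E.
Proof.
move=> /[dup] uT /andP[u0 _] vT FA mE.
rewrite drift_kernelE; last exact: measurable_rectangle.
rewrite mark_rectangle /strip_measure /= /mrestr.
case: ifPn => Aw; last by rewrite set0I measure0.
rewrite -product_measure1E//=; congr (_ _).
apply/seteqP; split => -[s x] /=; rewrite !in_itv/= le_min.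
  by move=> [[/andP[-> ->] Ex] [/andP[_ ->]]].
move=> [/andP[us /andP[-> st]] Ex]; rewrite us st; split => //.
by rewrite (le_lt_trans u0).
Qed.

Let D0 : set PP := (`]0, T] `*` setT) `*` setT.

Let D0rect : 0 <= (0 : R) <= T. Proof. by rewrite lexx ltW. Qed.

(** The generating class contains [setT], which is not a rectangle over a bounded interval. Both
    kernels are carried by [D0], which is one, so claims about [setT] reduce to rectangles. *)
Lemma jump_kernel_setT t omega : jump_kernel t omega setT = jump_kernel t omega D0.
Proof.
rewrite /jump_kernel !dirac_seqE !big_map !big_filter.
rewrite big_seq_cond [RHS]big_seq_cond; apply: eq_bigr => -[s x].
move=> /andP[sp _]; rewrite !diracE in_setT mem_set// /D0/= in_itv/=.
by rewrite (points_gt0 _ sp)//; exact: (hpt.1 omega).2.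
Qed.

Lemma drift_kernel_setT t omega : t <= T ->
  drift_kernel t omega setT = drift_kernel t omega D0.
Proof.
move=> tT; rewrite !drift_kernelE//; last first.
  by apply: measurable_rectangle => //; exact: filtrationT.
rewrite preimage_setT mark_rectangle in_setT /strip_measure /= /mrestr setTI.
congr (_ _); apply/seteqP; split => -[s x] /=; rewrite !in_itv/=; last by case.
by move=> [/andP[s0 st] _]; rewrite s0 st (le_trans st tT).
Qed.

(* Dynkin's lemma, in the filtration at time t: this gives adaptedness and not only
   measurability. *)
Lemma measurable_kernel_of_rectangles (t : R) (k : Omega -> {measure set PP -> \bar R}) :
  (forall omega, (k omega setT < +oo)%E) ->
  (forall D, predictable_rectangle P T B pp D ->
    measurable_wrt (F t) (fun omega => k omega D)) ->
  forall D, measurable D -> measurable_wrt (F t) (fun omega => k omega D).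
Proof.
move=> kfin kD D mD; apply/measurable_wrtP.
have {}mD : <<s predictable_rectangle P T B pp >> D by []; move: D mD.
apply: (dynkin_induction (T := PP)) => //.
- exact: predictable_rectangle_setI.
- by apply/measurable_wrtP; apply: kD; left.
- by move=> D rD; apply/measurable_wrtP; exact: kD.
- move=> D {}mD mk; under eq_fun => omega do rewrite -setTD measureD//= setTI.
  apply: emeasurable_funB => //.
  by apply/measurable_wrtP; apply: kD; left.
- move=> D {}mD tD mk.
  apply: (emeasurable_fun_cvg (fun n (omega : filteredType P B pp t) => \sum_(0 <= i < n) k omega (D i))%E).
    by move=> n; apply: emeasurable_sum.
  move=> omega _; apply: measure_semi_sigma_additive => //.
  exact: bigcupT_measurable.
Qed.

Lemma measurable_wrt_if t (A : set Omega) (g : Omega -> \bar R) : F t A ->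
  measurable_wrt (F t) g ->
  measurable_wrt (F t) (fun omega => if omega \in A then g omega else 0%E).
Proof.
move=> FA /measurable_wrtP mg; apply/measurable_wrtP.
apply: measurable_fun_ifT => //; apply: (@measurable_fun_bool _ _ _ _ true).
rewrite setTI measurable_filteredE.
rewrite (_ : _ @^-1` _ = A)//.
by apply/seteqP; split => w /=; [move=> /set_mem|move=> /mem_set].
Qed.

(** Cutting at t is what gives adaptedness: a rectangle starting at u <= t contributes a count over
    ]u, min v t] on a set A of F u, included in F t, and a rectangle starting after t contributes
    nothing. *)
Lemma measurable_jump_kernel t D : t <= T -> measurable D ->
  measurable_wrt (F t) (fun omega => jump_kernel t omega D).
Proof.
move=> tT; apply: measurable_kernel_of_rectangles.
  by move=> omega; rewrite ltey_eq dirac_seq_fin_num.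
have rect u v A E : 0 <= u <= T -> v <= T -> F u A -> measurable E ->
    measurable_wrt (F t) (fun omega => jump_kernel t omega ((`]u, v] `*` A) `*` E)).
  move=> /andP[u0 uT] vT FA mE.
  have [ut|tu] := leP u t.
    under eq_fun do rewrite jump_kernel_rectangle.
    apply: measurable_wrt_if; first exact: filtration_sub FA.
    apply: (count_wrt hpt hnu) => //.
    by rewrite ge_min lexx orbT.
  under eq_fun do rewrite jump_kernel_rectangle.
  rewrite (_ : (fun _ => _) = cst 0%E); first exact/measurable_wrtP/measurable_cst.
  apply/funext => omega; case: ifPn => // _.
  rewrite set_itv_ge ?set0X ?measure0// bnd_simp -leNgt ge_min.
  by rewrite (ltW tu) orbT.
move=> _ [->|[u [v [A [E [uT vT FA mE ->]]]]]]; last exact: rect.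
under eq_fun do rewrite jump_kernel_setT.
by apply: rect => //; exact: filtrationT.
Qed.

Lemma drift_kernel_total t omega : t <= T -> drift_kernel t omega setT =
  (fine (lebesgue_measure `]0%R, Num.min T t]) * fine (nu setT))%:E.
Proof.
move=> tT; rewrite drift_kernel_setT// drift_kernel_rectangle//; last exact: filtrationT.
rewrite in_setT EFinM !fineK ?fin_num_measure// lebesgue_measure_itv/=.
by case: ifPn.
Qed.

Lemma measurable_drift_kernel t D : t <= T -> measurable D ->
  measurable_wrt (F t) (fun omega => drift_kernel t omega D).
Proof.
move=> tT; apply: measurable_kernel_of_rectangles.
  by move=> omega; rewrite drift_kernel_total// ltry.
have rect u v A E : 0 <= u <= T -> v <= T -> F u A -> measurable E ->
    measurable_wrt (F t) (fun omega => drift_kernel t omega ((`]u, v] `*` A) `*` E)).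
  move=> /[dup] uT' /andP[u0 uT] vT FA mE.
  under eq_fun do rewrite drift_kernel_rectangle//.
  have [ut|tu] := leP u t.
    apply: measurable_wrt_if; first exact: filtration_sub FA.
    exact/measurable_wrtP/measurable_cst.
  rewrite (_ : (fun _ => _) = cst 0%E); first exact/measurable_wrtP/measurable_cst.
  apply/funext => omega; case: ifPn => // _.
  rewrite set_itv_ge ?measure0 ?mul0e// bnd_simp -leNgt ge_min.
  by rewrite (ltW tu) orbT.
move=> _ [->|[u [v [A [E [uT vT FA mE ->]]]]]]; last exact: rect.
under eq_fun do rewrite drift_kernel_setT//.
by apply: rect => //; exact: filtrationT.
Qed.

Lemma measurable_wrt_fun t dV (V : measurableType dV) (Y : Omega -> V) : t <= T ->
  measurable_wrt (F t) Y -> measurable_fun setT Y.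
Proof. by move=> tT mY _ C mC; rewrite setTI; apply: (hF tT); exact: mY. Qed.

Section compensation.
Variable t : R.
Hypothesis tT : t <= T.

Definition mjump U mU := measurable_wrt_fun tT (@measurable_jump_kernel t U tT mU).
Definition mdrift U mU := measurable_wrt_fun tT (@measurable_drift_kernel t U tT mU).

(** On rectangles this is [expectation_point_measure]. Rectangles are stable under intersection and
    the total mass, computed on the drift side, is finite, so the two measures coincide. *)
Lemma compensation D : measurable D -> mixture P mjump D = mixture P mdrift D.
Proof.
have rect u v A E : 0 <= u <= T -> v <= T -> F u A -> measurable E ->
    (\int[P]_omega jump_kernel t omega ((`]u, v] `*` A) `*` E) =
    \int[P]_omega drift_kernel t omega ((`]u, v] `*` A) `*` E))%E.
  move=> uT vT FA mE; have mA : measurable A.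
    by case/andP: uT => _ uT; exact: (hF uT).
  under eq_integral do rewrite jump_kernel_rectangle.
  under [RHS]eq_integral do rewrite drift_kernel_rectangle//.
  rewrite -[LHS]/(\int[P]_omega ((fun omega =>
    point_measure pp omega (`]u, Num.min v t] `*` E)) \_ A) omega)%E.
  rewrite -[RHS]/(\int[P]_omega ((cst
    (lebesgue_measure `]u, Num.min v t] * nu E)%E) \_ A) omega)%E.
  rewrite -!integral_mkcond integral_cst// muleC.
  apply: (expectation_point_measure hpt hF hnu) => //.
  by rewrite ge_min vT.
have rectG D' : predictable_rectangle P T B pp D' ->
    mixture P mjump D' = mixture P mdrift D'.
  move=> [->|[u [v [A [E [uT vT FA mE ->]]]]]]; last exact: rect.
  rewrite /mixture; under eq_integral do rewrite jump_kernel_setT.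
  under [RHS]eq_integral do rewrite drift_kernel_setT//.
  by apply: rect => //; exact: filtrationT.
move=> mD; apply: (@measure_unique _ R PP (predictable_rectangle P T B pp)
  (fun=> setT) _ _ _ _ (mixture P mjump) (mixture P mdrift)) => //.
- exact: predictable_rectangle_setI.
- by move=> _; left.
- by rewrite bigcup_const.
- move=> _; rewrite /= rectG; last by left.
  rewrite /mixture; under eq_integral do rewrite drift_kernel_total//.
  by rewrite integral_cst// -[X in (_ * X)%E]fineK ?fin_num_measure// -EFinM ltry.
Qed.

End compensation.

End KernelsOnPredictable.

Section integral_mrestr.
Context d (Z : measurableType d) (R : realType) (mu : {measure set Z -> \bar R}).
Variables (D : set Z) (mD : measurable D).

Lemma integral_mrestr (f : Z -> \bar R) : measurable_fun setT f ->
  (\int[mrestr mu mD]_z f z = \int[mu]_(z in D) f z)%E.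
Proof.
move=> mf; transitivity (\int[mrestr mu mD]_(z in D) f z)%E; last first.
  by apply: eq_measure_integral => A mA AD; rewrite /= /mrestr setIidl.
rewrite [RHS]integral_mkcond; apply: ae_eq_integral => //.
  by apply/(measurable_restrictT _ mD); exact: measurable_funTS.
exists (~` D); split; first exact: measurableC.
  by rewrite /= /mrestr setICl measure0.
by move=> z /= nh Dz; apply: nh => _; rewrite patchE mem_set.
Qed.

End integral_mrestr.

(** * Sum over the points and drift of a scalar field *)

Section FieldIntegrals.
Context {R : realType} {dO dX : measure_display} {Omega : measurableType dO}
  {X : measurableType dX} (P : probability Omega R) (d : nat) (T : R)
  (B : R -> Omega -> 'rV[R]_d) (pp : Omega -> R -> option X)
  (nu : {finite_measure set X -> \bar R}).

Local Notation F := (filtration P B pp).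
Local Notation mR := (measurableTypeR R).
Local Notation PP := (predictableType P T B pp).
Local Notation mark := (@mark _ _ _ _ _ P _ T B pp).
Local Notation strip t := (`]0%R, t] `*` setT : set (mR * X)%type).
Local Notation lnu := (@lebesgue_measure R \x nu)%E.

Hypothesis hT : 0 < T.
Hypothesis hpt : point_process pp T.
Hypothesis hnu : compensator P T F pp nu.

Definition jump_sum (g : PP -> R) t omega : R :=
  \sum_(z <- points_upto pp t omega) g (mark omega z).

(** [fine] gives the drift the value 0 where the integral is infinite; for an L1 field this happens
    on a null set of paths only. *)
Definition drift (g : PP -> R) t omega : R :=
  fine (\int[lnu]_(z in strip t) (g (mark omega z))%:E)%E.

Lemma jump_sumE (g : PP -> R) t omega : measurable_fun setT g ->
  (\int[jump_kernel P T B pp t omega]_z (g z)%:E)%E = (jump_sum g t omega)%:E.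
Proof. by move=> mg; rewrite integral_dirac_seq// big_map. Qed.

Lemma measurable_comp_mark d' (V : measurableType d') (g : PP -> V) omega :
  measurable_fun setT g -> measurable_fun setT (g \o mark omega).
Proof. by move=> mg; apply: measurableT_comp => //; exact: measurable_mark. Qed.

Lemma ge0_integral_drift_kernel (g : PP -> \bar R) t omega :
  measurable_fun setT g -> (forall z, 0 <= g z)%E ->
  (\int[drift_kernel P T B pp nu t omega]_z g z =
   \int[lnu]_(z in strip t) g (mark omega z))%E.
Proof.
move=> mg g0; rewrite /drift_kernel.
have E := @ge0_integral_mixture _ _ _ _ R (strip_measure nu t) _
  (@measurable_dirac_mark _ _ _ _ _ P d T B pp omega) g g0 mg.
apply: (etrans E).
rewrite -(integral_mrestr _ (measurable_strip t)); last exact: measurable_comp_mark.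
by apply: eq_integral => z _; rewrite integral_dirac// diracT mul1e.
Qed.

Lemma integral_drift_kernel (g : PP -> \bar R) t omega : measurable_fun setT g ->
  (\int[drift_kernel P T B pp nu t omega]_z g z =
   \int[lnu]_(z in strip t) g (mark omega z))%E.
Proof.
move=> mg; rewrite integralE !ge0_integral_drift_kernel//;
  [|exact: measurable_funeneg|exact: measurable_funepos].
rewrite [RHS]integralE; congr (_ - _)%E; apply: eq_integral => z _.
  by rewrite !funeposE.
by rewrite !funenegE.
Qed.

Lemma measurable_wrt_integral_kernel t (k : Omega -> {measure set PP -> \bar R}) (g : PP -> \bar R) :
  (forall U, measurable U -> measurable_wrt (F t) (fun omega => k omega U)) ->
  measurable_fun setT g ->
  measurable_wrt (F t) (fun omega => \int[k omega]_z g z)%E.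
Proof.
move=> mk mg; apply/measurable_wrtP; under eq_fun do rewrite integralE.
have mk' U : measurable U -> measurable_fun setT ((fun omega => k omega U) : filteredType P B pp t -> _).
  by move=> mU; apply/measurable_wrtP; exact: mk.
apply: emeasurable_funB; apply: measurable_fun_integral_kernel => //.
- exact: measurable_funepos.
- exact: measurable_funeneg.
Qed.

Lemma jump_sum_wrt (g : PP -> R) t : t <= T -> measurable_fun setT g ->
  measurable_wrt (F t) (jump_sum g t).
Proof.
move=> tT mg; apply/measurable_wrtP; apply/measurable_EFinP; apply/measurable_wrtP.
rewrite (_ : _ \o _ = fun omega => \int[jump_kernel P T B pp t omega]_z (g z)%:E)%E.
  apply: measurable_wrt_integral_kernel; last exact/measurable_EFinP.
  by move=> U mU; exact: measurable_jump_kernel hnu _ _ _ _.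
by apply/funext => omega; rewrite jump_sumE.
Qed.

Lemma drift_wrt (g : PP -> R) t : t <= T -> measurable_fun setT g ->
  measurable_wrt (F t) (drift g t).
Proof.
move=> tT mg; have mEg : measurable_fun setT (EFin \o g) by exact/measurable_EFinP.
rewrite (_ : drift g t = fun omega =>
    fine (\int[drift_kernel P T B pp nu t omega]_z (g z)%:E)%E); last first.
  by apply/funext => omega; rewrite /drift integral_drift_kernel.
apply/measurable_wrtP; apply: measurableT_comp => //; apply/measurable_wrtP.
by apply: measurable_wrt_integral_kernel => //; move=> U mU; exact: measurable_drift_kernel.
Qed.

End FieldIntegrals.

(** * Compensated integrals of scalar fields *)

Section L1Fields.
Context {R : realType} {dO dX : measure_display} {Omega : measurableType dO}
  {X : measurableType dX} (P : probability Omega R) (d : nat) (T : R)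
  (B : R -> Omega -> 'rV[R]_d) (pp : Omega -> R -> option X)
  (nu : {finite_measure set X -> \bar R}).

Local Notation F := (filtration P B pp).
Local Notation mR := (measurableTypeR R).
Local Notation PP := (predictableType P T B pp).
Local Notation mark := (@mark _ _ _ _ _ P _ T B pp).
Local Notation strip t := (`]0%R, t] `*` setT : set (mR * X)%type).
Local Notation lnu := (@lebesgue_measure R \x nu)%E.
Local Notation jump_sum := (@jump_sum _ _ _ _ _ P _ T B pp).
Local Notation drift := (@drift _ _ _ _ _ P _ T B pp nu).

Hypothesis hT : 0 < T.
Hypothesis hpt : point_process pp T.
Hypothesis hF : forall t, t <= T -> F t `<=` measurable.
Hypothesis hnu : compensator P T F pp nu.

Let mjumpT := @mjump _ _ _ _ _ P _ T B pp nu hT hpt hF hnu T (lexx T).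
Let mdriftT := @mdrift _ _ _ _ _ P _ T B pp nu hT hF T (lexx T).

Definition L1_field (g : PP -> R) := measurable_fun setT g /\
  (\int[P]_omega \int[lnu]_(z in strip T) `|(g (mark omega z))%:E| < +oo)%E.

(** The mixture of the drift kernels is dP dt dnu on the predictable space, so L1 fields inherit
    domination, sums and dominated convergence from integrable functions. *)
Lemma L1_fieldP g :
  L1_field g <-> (mixture P mdriftT).-integrable setT (EFin \o g).
Proof.
have E : measurable_fun setT g ->
    (\int[mixture P mdriftT]_z `|(g z)%:E| =
     \int[P]_omega \int[lnu]_(z in strip T) `|(g (mark omega z))%:E|)%E.
  move=> mg; have mEg : measurable_fun setT (EFin \o g) by exact/measurable_EFinP.
  rewrite ge0_integral_mixture//; last exact: measurableT_comp.
  apply: eq_integral => omega _.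
  rewrite (integral_drift_kernel _ _ (g := fun z => `|(g z)%:E|%E))//.
  exact: measurableT_comp.
split=> [[mg gfin]|/integrableP[mEg gfin]].
  by apply/integrableP; split; [exact/measurable_EFinP|rewrite /= E].
have mg : measurable_fun setT g by exact/measurable_EFinP.
by split => //; rewrite -E.
Qed.

Lemma L1_field_integrable g : L1_field g ->
  (mixture P mdriftT).-integrable setT (EFin \o g).
Proof. by move/L1_fieldP. Qed.

Lemma L1_field_le (g g' : PP -> R) : measurable_fun setT g' ->
  (forall z, `|g' z| <= `|g z|) -> L1_field g -> L1_field g'.
Proof.
move=> mg' gg' /L1_fieldP gL; apply/L1_fieldP; apply: le_integrable gL => //.
  exact/measurable_EFinP.
by move=> z _ /=; rewrite lee_fin.
Qed.

(** The two mixtures are the same measure by [compensation], so integrability passes from the drift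
    to the points. *)
Lemma L1_field_integrable_jump g : L1_field g ->
  (mixture P mjumpT).-integrable setT (EFin \o g).
Proof.
move=> /L1_field_integrable/integrableP[mg gfin]; apply/integrableP; split => //.
move: gfin; congr (_ < _)%E; apply: eq_measure_integral => D mD _.
exact/esym/compensation.
Qed.

Lemma ae_integrable_L1_field g : L1_field g ->
  {ae P, forall omega, lnu.-integrable (strip T) (fun z => (g (mark omega z))%:E)}.
Proof.
move=> /[dup] -[mg _] /L1_field_integrable/ae_integrable_mixture.
apply: filterS => omega /integrableP[mEg gfin]; apply/integrableP; split.
  by apply: measurable_funTS; exact: (measurable_comp_mark omega mEg).
move: gfin; rewrite integral_drift_kernel//.
exact: measurableT_comp.
Qed.

Lemma integrable_jump_sum g : L1_field g ->
  P.-integrable setT (EFin \o jump_sum g T).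
Proof.
move=> gL; have [mg _] := gL.
have := integrable_mixture (L1_field_integrable_jump gL).
by under eq_fun do rewrite jump_sumE//.
Qed.

(** An integrable function is finite almost everywhere, so [fine] changes it on a null set only. *)
Lemma integrable_fine_ae (f : Omega -> \bar R) : P.-integrable setT f ->
  P.-integrable setT (fun omega => (fine (f omega))%:E) /\
  (\int[P]_omega (fine (f omega))%:E = \int[P]_omega f omega)%E.
Proof.
move=> fi; have mf := measurable_int P fi.
have mf' : measurable_fun setT (fun omega => (fine (f omega))%:E).
  by apply/measurable_EFinP; exact: measurableT_comp.
have ff : ae_eq P setT f (fun omega => (fine (f omega))%:E).
  by apply: filterS (integrable_ae measurableT fi) => omega h I; rewrite fineK// h.
split; last by apply: ae_eq_integral => //; exact: ae_eq_sym.
apply/integrableP; split => //; case/integrableP: fi => _.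
congr (_ < _)%E; apply: ae_eq_integral => //; do ?exact: measurableT_comp.
exact: ae_eq_abse.
Qed.

Lemma driftE g omega : measurable_fun setT g ->
  drift g T omega = fine (\int[drift_kernel P T B pp nu T omega]_z (g z)%:E)%E.
Proof.
by move=> mg; rewrite /drift integral_drift_kernel//; exact/measurable_EFinP.
Qed.

Lemma integrable_drift g : L1_field g -> P.-integrable setT (EFin \o drift g T).
Proof.
move=> gL; have [mg _] := gL.
have := integrable_mixture (L1_field_integrable gL).
by move=> /integrable_fine_ae[+ _]; under eq_fun do rewrite -driftE//.
Qed.

Lemma expectation_jump_sum g : L1_field g ->
  (\int[P]_omega (jump_sum g T omega)%:E = \int[P]_omega (drift g T omega)%:E)%E.
Proof.
move=> gL; have [mg _] := gL.
under eq_integral do rewrite -jump_sumE//.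
under [RHS]eq_integral do rewrite driftE//.
rewrite (integrable_fine_ae (integrable_mixture (L1_field_integrable gL))).2.
rewrite -!integral_mixture//; [|exact: L1_field_integrable|exact: L1_field_integrable_jump].
by apply: eq_measure_integral => D mD _; exact: compensation.
Qed.

Lemma jump_sum_increment (g : PP -> R) s t A omega : s <= t -> t <= T ->
  jump_sum (fun z => \1_((`]s, t] `*` A) `*` setT) z * g z) T omega =
  \1_A omega * (jump_sum g t omega - jump_sum g s omega).
Proof.
move=> st tT; rewrite /jump_sum !big_filter !(big_mkcond (fun z => z.1 <= _)).
rewrite -sumrB mulr_sumr; apply: eq_bigr => -[r x] _ /=.
rewrite !indicE; have [rt|tr] := leP r t; last first.
  have -> : (r <= s) = false by rewrite leNgt (le_lt_trans st tr).
  rewrite subrr mulr0.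
  case: ifP => // _; rewrite memNset ?mul0r// => -[[/= + _] _].
  by rewrite in_itv/= leNgt tr andbF.
rewrite (le_trans rt tT); have [rs|sr] := leP r s.
  rewrite subrr mulr0 memNset ?mul0r// => -[[/= + _] _].
  by rewrite in_itv/= ltNge rs.
rewrite subr0; congr (_ * _); congr ((nat_of_bool _)%:R).
apply/idP/idP => /set_mem h; apply/mem_set.
  by case: h => -[].
by rewrite /mark/=; split => //; split => //=; rewrite in_itv/= sr.
Qed.

(** The real-valued integral is additive in its domain only where the section is integrable, whence
    the condition on the path. The analogous identity for the points concerns finite sums. *)
Lemma drift_sub (g : PP -> R) s t omega : 0 <= s <= t -> t <= T ->
  lnu.-integrable (strip T) (fun z => (g (mark omega z))%:E) ->
  drift g t omega - drift g s omega =
  \int[lnu]_(z in `]s, t] `*` setT) g (mark omega z).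
Proof.
move=> /andP[s0 st] tT gi.
have mst : measurable (`]s, t] `*` setT : set (mR * X)%type).
  exact: measurableX.
have ms u : measurable (strip u) by exact: measurable_strip.
have stU : strip t = strip s `|` (`]s, t] `*` setT).
  apply/seteqP; split => -[r x] /=; rewrite !in_itv/=.
    move=> [/andP[r0 rt] _]; have [rs|sr] := leP r s; [left|right];
    by rewrite ?r0 ?sr.
  move=> [[/andP[r0 rs] _]|[/andP[sr rt] _]]; split => //.
    by rewrite r0 (le_trans rs).
  by rewrite (le_lt_trans s0 sr).
have subT : strip t `<=` strip T.
  by move=> -[r x] /=; rewrite !in_itv/= => -[/andP[-> rt] _]; rewrite (le_trans rt).
rewrite -[drift g t omega]/(\int[lnu]_(z in strip t) g (mark omega z))%R stU.
rewrite Rintegral_setU//; first by rewrite addrAC subrr add0r.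
  by rewrite -stU; exact: integrableS gi.
rewrite disj_set2E; apply/eqP/seteqP; split => // -[r x] /=.
by rewrite !in_itv/= => -[[/andP[_ rs] _] [/andP[+ _] _]]; rewrite ltNge rs.
Qed.

Lemma sub_strip s t : 0 <= s -> t <= T ->
  `]s, t] `*` setT `<=` (strip T : set (mR * X)).
Proof.
move=> s0 tT -[r x] /=; rewrite !in_itv/= => -[/andP[sr rt] _].
by rewrite (le_lt_trans s0 sr) (le_trans rt).
Qed.

Lemma drift_increment (g : PP -> R) s t A omega : 0 <= s <= t -> t <= T ->
  lnu.-integrable (strip T) (fun z => (g (mark omega z))%:E) ->
  drift (fun z => \1_((`]s, t] `*` A) `*` setT) z * g z) T omega =
  \1_A omega * (drift g t omega - drift g s omega).
Proof.
move=> st0 tT gi; rewrite drift_sub//.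
have s0 : 0 <= s by case/andP: st0.
pose phi z := g (mark omega z).
have mst : measurable (`]s, t] `*` setT : set (mR * X)%type).
  exact: measurableX.
have ms u : measurable (strip u) by exact: measurable_strip.
transitivity (\int[lnu]_(z in strip T) (\1_A omega *
    (phi \_ (`]s, t] `*` setT)) z))%R.
  apply: eq_Rintegral => -[r x] _; rewrite /phi patchE.
  rewrite !indicE; have [rst|rst] := boolP ((r, x) \in _).
    congr (_ * _); congr ((nat_of_bool _)%:R).
    apply/idP/idP => /set_mem h; apply/mem_set; first by case: h => -[].
    by move/set_mem: rst => [? ?]; split.
  rewrite memNset ?mul0r ?mulr0// => -[[/= rst' _] _].
  by move/negP: rst; apply; exact/mem_set.
have sub2 := sub_strip s0 tT.
have pis : lnu.-integrable (strip T) (EFin \o (phi \_ (`]s, t] `*` setT))).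
  rewrite -restrict_EFin; apply: (integrable_restrict _ mst (ms T) _).1.
  by rewrite setIidr//; exact: integrableS gi.
rewrite RintegralZl//.
by rewrite -Rintegral_mkcondr setIidr.
Qed.

Lemma jump_sum_norm (g : PP -> R) t omega :
  t <= T -> `|jump_sum g t omega| <= jump_sum (fun z => `|g z|) T omega.
Proof.
move=> tT; apply: le_trans (ler_norm_sum _ _ _) _.
rewrite /jump_sum !big_filter !(big_mkcond (fun z => z.1 <= _)).
apply: ler_sum => -[r x] _ /=; case: ifPn => rt; last by case: ifP.
by rewrite (le_trans rt tT).
Qed.

Lemma drift_norm (g : PP -> R) t omega : t <= T ->
  lnu.-integrable (strip T) (fun z => (g (mark omega z))%:E) ->
  `|drift g t omega| <= drift (fun z => `|g z|) T omega.
Proof.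
move=> tT gi; have ms u : measurable (strip u) by exact: measurable_strip.
have subT : strip t `<=` strip T.
  by move=> -[r x] /=; rewrite !in_itv/= => -[/andP[-> rt] _]; rewrite (le_trans rt).
have git : lnu.-integrable (strip t) (EFin \o (g \o mark omega)).
  exact: integrableS gi.
apply: le_trans (le_normr_Rintegral _ git) _ => //.
have ngi : lnu.-integrable (strip T) (fun z => `|g (mark omega z)|%:E).
  exact: (integrable_norm gi).
rewrite /drift -[leLHS]/(fine _); apply: fine_le.
- exact: integrable_fin_num (integrableS _ _ subT ngi).
- exact: integrable_fin_num ngi.
apply: ge0_subset_integral => //; exact: measurable_int ngi.
Qed.

End L1Fields.

Section Compensated.
Context {R : realType} {dO dX : measure_display} {Omega : measurableType dO}
  {X : measurableType dX} (P : probability Omega R) (d : nat) (T : R)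
  (B : R -> Omega -> 'rV[R]_d) (pp : Omega -> R -> option X)
  (nu : {finite_measure set X -> \bar R}).

Local Notation F := (filtration P B pp).
Local Notation PP := (predictableType P T B pp).
Local Notation mark := (@mark _ _ _ _ _ P _ T B pp).
Local Notation jump_sum := (@jump_sum _ _ _ _ _ P _ T B pp).
Local Notation drift := (@drift _ _ _ _ _ P _ T B pp nu).
Local Notation L1_field := (@L1_field _ _ _ _ _ P _ T B pp nu).

Hypothesis hT : 0 < T.
Hypothesis hpt : point_process pp T.
Hypothesis hF : forall t, t <= T -> F t `<=` measurable.
Hypothesis hnu : compensator P T F pp nu.

Definition compensated (g : PP -> R) t omega := jump_sum g t omega - drift g t omega.

Lemma compensated_wrt g t : t <= T -> measurable_fun setT g ->
  measurable_wrt (F t) (compensated g t).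
Proof.
move=> tT mg; apply/measurable_wrtP; apply: measurable_funB.
- by apply/measurable_wrtP; exact: (jump_sum_wrt hT hpt hnu).
- by apply/measurable_wrtP; exact: drift_wrt.
Qed.

Lemma L1_field_norm g : L1_field g -> L1_field (fun z => `|g z|).
Proof.
move=> gL; apply: (L1_field_le hT hF _ _ gL).
  by case: gL => mg _; exact: measurableT_comp.
by move=> z; rewrite normr_id.
Qed.

(** The bound does not depend on t. It yields integrability, then uniform integrability, and square
    integrability for bounded fields. *)
Lemma ae_compensated_norm g : L1_field g -> {ae P, forall omega, forall t, t <= T ->
  `|compensated g t omega| <= jump_sum (fun z => `|g z|) T omega +
                              drift (fun z => `|g z|) T omega}.
Proof.
move=> gL; have := ae_integrable_L1_field hT hF gL.
apply: filterS => omega gi t tT; apply: (le_trans (ler_normB _ _)).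
by apply: lerD; [exact: jump_sum_norm|exact: drift_norm].
Qed.

Lemma integrable_dominator g : L1_field g ->
  P.-integrable setT (fun omega => (jump_sum (fun z => `|g z|) T omega +
                              drift (fun z => `|g z|) T omega)%:E).
Proof.
move=> /L1_field_norm gL; under eq_fun do rewrite EFinD.
apply: integrableD => //.
- exact: (integrable_jump_sum hT hpt hF hnu).
- exact: integrable_drift.
Qed.

Lemma measurable_compensated g t : t <= T -> measurable_fun setT g ->
  measurable_fun setT (compensated g t).
Proof. by move=> tT mg; apply: (measurable_wrt_fun hF tT); exact: compensated_wrt. Qed.

Lemma integrable_compensated g t : L1_field g -> t <= T ->
  P.-integrable setT (EFin \o compensated g t).
Proof.
move=> gL tT; have [mg _] := gL.
have /integrableP[_ dfin] := integrable_dominator gL.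
apply/integrableP; split; first exact/measurable_EFinP/measurable_compensated.
apply: le_lt_trans dfin; apply: ae_ge0_le_integral => //.
- by apply: measurableT_comp => //; exact/measurable_EFinP/measurable_compensated.
- apply: measurableT_comp => //; apply: (measurable_int P).
  exact: integrable_dominator.
apply: filterS (ae_compensated_norm gL) => omega /(_ t tT) h _ /=.
by rewrite lee_fin (le_trans h)// ler_norm.
Qed.

Lemma compensated_increment g s t A : L1_field g -> 0 <= s <= t -> t <= T ->
  F s A ->
  (\int[P]_(omega in A) (compensated g t omega - compensated g s omega)%:E = 0)%E.
Proof.
move=> gL /[dup] st0 /andP[s0 st] tT FA; have mA : measurable A.
  by apply: (hF _ FA); exact: le_trans tT.
have [mg _] := gL.
(* As A is in F s, the set ]s, t] x A is predictable; its indicator is at most 1, so [g'] is again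
   an L1 field. *)
pose g' z := \1_((`]s, t] `*` A) `*` setT : set PP) z * g z.
have mg' : measurable_fun setT g'.
  apply: measurable_funM => //; apply: measurable_indic.
  by apply: measurable_rectangle => //; rewrite s0 (le_trans st).
have gL' : L1_field g'.
  apply: (L1_field_le hT hF _ _ gL) => // z.
  by rewrite normrM ger0_norm// ler_piMl// indic_le1.
rewrite integral_mkcond.
transitivity (\int[P]_omega ((jump_sum g' T omega)%:E - (drift g' T omega)%:E))%E.
  apply: ae_eq_integral => //.
  - apply/(measurable_restrictT _ mA); apply: measurable_funTS.
    by apply/measurable_EFinP; apply: measurable_funB;
      apply: measurable_compensated => //; exact: le_trans tT.
  - apply: emeasurable_funB; apply: (measurable_int P).
      exact: (integrable_jump_sum hT hpt hF hnu).
    exact: integrable_drift.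
  apply: filterS (ae_integrable_L1_field hT hF gL) => omega gi _.
  rewrite /g' jump_sum_increment// drift_increment// -EFinB.
  rewrite patchE indicE; case: ifPn => Aw /=; congr EFin.
    by rewrite !mul1r /compensated opprB !addrA; ring.
  by rewrite !mul0r subrr.
rewrite integralB//.
- rewrite (expectation_jump_sum hT hpt hF hnu)// subee//.
  by apply: integrable_fin_num => //; exact: integrable_drift.
- exact: (integrable_jump_sum hT hpt hF hnu).
- exact: integrable_drift.
Qed.

(** Stated for a process Y equal to [compensated g] almost surely at each time, since the
    coordinates of [compensated_integral] and of its stopped versions are only known in this
    form. *)
Lemma rmartingale_compensated g (Y : R -> Omega -> R) : L1_field g ->
  (forall t, 0 <= t <= T -> {ae P, forall omega, Y t omega = compensated g t omega}) ->
  rmartingale P T F Y.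
Proof.
move=> gL Yg; have [mg _] := gL.
have aY : adapted T F Y.
  move=> t /[dup] t0T /andP[t0 tT].
  apply: (ae_measurable_wrt (Y := compensated g t)); last exact: compensated_wrt.
  by apply: filterS (Yg t t0T).
have mY t : 0 <= t <= T -> measurable_fun setT (Y t).
  by move=> /[dup] t0T /andP[_ tT]; apply: (measurable_wrt_fun hF tT); exact: aY.
have iY t : 0 <= t <= T -> P.-integrable setT (EFin \o Y t).
  move=> /[dup] t0T /andP[t0 tT].
  have /integrableP[_ cfin] := integrable_compensated gL tT.
  apply/integrableP; split; first exact/measurable_EFinP/mY.
  move: cfin; congr (_ < _)%E; apply: ae_eq_integral => //.
  - by apply: measurableT_comp => //; exact/measurable_EFinP/measurable_compensated.
  - by apply: measurableT_comp => //; exact/measurable_EFinP/mY.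
  by apply: filterS (Yg t t0T) => omega /= ->.
split => // s t A /[dup] st0 /andP[s0 st] tT FA.
have sT := le_trans st tT.
have mA : measurable A by exact: (hF _ FA).
have h0 : (\int[P]_(omega in A) ((Y t omega)%:E - (Y s omega)%:E) = 0)%E.
  rewrite -(compensated_increment gL st0 tT FA); apply: ae_eq_integral => //.
  - apply: emeasurable_funB; apply: measurable_funTS; apply/measurable_EFinP;
    by apply: mY; rewrite ?s0// (le_trans s0).
  - apply: measurable_funTS; apply/measurable_EFinP.
    by apply: measurable_funB; exact: measurable_compensated.
  have s0T : 0 <= s <= T by rewrite s0.
  have t0T : 0 <= t <= T by rewrite (le_trans s0).
  by apply: filterS2 (Yg s s0T) (Yg t t0T) => omega -> -> _.
have iYA u : 0 <= u <= T -> P.-integrable A (EFin \o Y u).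
  by move=> /iY; apply: integrableS.
have it : P.-integrable A (EFin \o Y t) by apply: iYA; rewrite (le_trans s0).
have is' : P.-integrable A (EFin \o Y s) by apply: iYA; rewrite s0.
move: h0; rewrite integralB//.
rewrite -(fineK (integrable_fin_num _ it))// -(fineK (integrable_fin_num _ is'))//.
by rewrite -EFinB => -[/eqP]; rewrite subr_eq0 => /eqP ->.
Qed.

End Compensated.

(** * Path regularity and sums of squared increments *)

Section StepFunctions.
Context {R : realType}.
Variable js : seq R.

Definition step (a : R -> R) (t : R) : R := \sum_(s <- js | s <= t) a s.

Lemma step_increment a u v : u <= v ->
  step a v - step a u = \sum_(s <- js | u < s <= v) a s.
Proof.
move=> uv; rewrite /step (bigID (fun s => s <= u))/= addrC.
rewrite [X in _ + X - _](eq_bigl (fun s => s <= u)) => [|s]; last first.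
  by rewrite andb_idl// => su; exact: le_trans uv.
rewrite addrK; apply: eq_bigl => s.
by rewrite -ltNge andbC.
Qed.

Lemma step_right_continuous a t : step a s @[s --> t^'+] --> step a t.
Proof.
rewrite /step (big_mkcond (fun s => s <= t)).
under eq_fun do rewrite big_mkcond.
apply: cvg_big => [|r _]; first exact: add_continuous.
 have [rt|tr] := leP r t.
  apply: cvg_near_cst; near=> s.
  have -> : r <= s by rewrite (le_trans rt)//; near: s; exact: nbhs_right_ge.
  by [].
apply: cvg_near_cst; near=> s.
have -> : (r <= s) = false; last by [].
by apply/negbTE; rewrite -ltNge; near: s; exact: nbhs_right_lt.
Unshelve. all: by end_near. Qed.

Lemma step_left_limit a t : step a s @[s --> t^'-] --> \sum_(s <- js | s < t) a s.
Proof.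
rewrite /step (big_mkcond (fun s => s < t)).
under eq_fun do rewrite big_mkcond.
apply: cvg_big => [|r _]; first exact: add_continuous.
 have [rt|tr] := ltP r t.
  apply: cvg_near_cst; near=> s.
  have -> : r <= s by near: s; exact: nbhs_left_ge.
  by [].
apply: cvg_near_cst; near=> s.
have -> : (r <= s) = false; last by [].
apply/negbTE; rewrite -ltNge (lt_le_trans _ tr)//.
Unshelve. all: by end_near. Qed.

Lemma step_jump a t : uniq js ->
  step a t - \sum_(s <- js | s < t) a s = if t \in js then a t else 0.
Proof.
move=> ujs; rewrite /step (bigID (fun s => s < t))/= addrC.
rewrite [X in _ + X - _](eq_bigl (fun s => s < t)) => [|s]; last first.
  by rewrite andb_idl// => /ltW.
rewrite addrK (eq_bigl (pred1 t)) => [|s]; last first.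
  by rewrite -leNgt /= eq_le.
case: ifPn => tjs.
  rewrite big_mkcond (bigD1_seq t)//= eqxx big1 ?addr0// => s.
  by move=> /negbTE ->.
rewrite big1_seq// => s /= /andP[/eqP -> tj]; by rewrite tj in tjs.
Qed.

(* Below the smallest gap between jump times, an increment involves at most one jump. *)
Lemma step_square : uniq js -> exists2 delta, 0 < delta & forall a u v,
  u <= v -> v - u < delta ->
  (step a v - step a u) ^+ 2 = step (fun s => a s ^+ 2) v - step (fun s => a s ^+ 2) u.
Proof.
move=> ujs.
(* There are finitely many pairs of jump times, so one delta lies below all positive gaps. *)
have sep : \forall delta \near (0 : R)^'+, forall i j : 'I_(size js),
    js`_i < js`_j -> delta < js`_j - js`_i.
  apply: filter_forall => i; apply: filter_forall => j.
  have [ij|ij] := ltP js`_i js`_j; last exact: nearW.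
  by near=> delta => _; near: delta; apply: nbhs_right_lt; rewrite subr_gt0.
near (0 : R)^'+ => delta; exists delta; first by near: delta; exact: nbhs_right_gt.
have sepd : forall i j : 'I_(size js), js`_i < js`_j -> delta < js`_j - js`_i.
  by near: delta; exact: sep.
have gap r s : r \in js -> s \in js -> r < s -> delta < s - r.
  move=> rj sj; have ri : (index r js < size js)%N by rewrite index_mem.
  have si : (index s js < size js)%N by rewrite index_mem.
  by have := sepd (Ordinal ri) (Ordinal si); rewrite /= !nth_index.
move=> a u v uv uvd; rewrite !step_increment//.
rewrite -big_filter -[RHS]big_filter.
have : {in [seq s <- js | u < s <= v] &, forall r s, r = s}.
  move=> r s; rewrite !mem_filter => /andP[/andP[ur rv] rj] /andP[/andP[us sv] sj].
  apply/eqP; rewrite eq_le !leNgt; apply/andP; split; apply/negP => rs.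
    by have := gap _ _ sj rj rs; lra.
  by have := gap _ _ rj sj rs; lra.
(* A duplicate-free list whose entries are all equal has at most one entry. *)
have := filter_uniq (fun s => u < s <= v) ujs.
case: [seq s <- js | _] => [|r [|s l]] /=.
- by rewrite !big_nil expr0n.
- by rewrite !big_seq1.
- move=> /andP[+ _] => /[swap] /(_ r s).
  by rewrite !inE !eqxx orbT => /(_ isT isT) ->; rewrite eqxx.
Unshelve. all: by end_near. Qed.

Lemma step_norm a u v : u <= v ->
  `|step a v - step a u| <= step (fun s => `|a s|) v - step (fun s => `|a s|) u.
Proof. by move=> uv; rewrite !step_increment//; exact: ler_norm_sum. Qed.

End StepFunctions.

Section PartitionSums.
Context {R : realType}.

(** The increments of K telescope along the partition. The starting point u is arbitrary so that the
    induction can drop the first interval. *)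
Lemma partition_sum (G : R -> R -> R) (K : R -> R) (e delta T : R) :
  (forall u v, 0 <= u -> u <= v -> v <= T -> v - u < delta ->
     `|G u v| <= e * (K v - K u)) ->
  forall s u, 0 <= u -> path <%R u s -> last u s <= T ->
  (forall k, (k < size s)%N -> nth 0 s k - nth 0 (u :: s) k < delta) ->
  `|\sum_(k < size s) G (nth 0 (u :: s) k) (nth 0 s k)| <= e * (K (last u s) - K u).
Proof.
move=> GK; elim=> [|v s ih] u u0 /=.
  by move=> _ _ _; rewrite big_ord0 normr0 subrr mulr0.
move=> /andP[uv pvs] lT gap.
have vl : v <= last v s.
  elim: s v pvs {ih lT gap uv} => //= w s ih v /andP[vw /ih].
  by apply: le_trans; exact: ltW.
rewrite big_ord_recl /=; apply: (le_trans (ler_normD _ _)).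
have -> : e * (K (last v s) - K u) =
    e * (K v - K u) + e * (K (last v s) - K v) by ring.
apply: lerD.
  by apply: GK => //; [exact: ltW|exact: le_trans lT|exact: (gap 0%N)].
apply: ih => //; first exact: le_trans (ltW uv).
by move=> k ks; exact: (gap k.+1).
Qed.

Lemma telescope_nth (A : R -> R) s u :
  \sum_(j < size s) (A (nth 0 s j) - A (nth 0 (u :: s) j)) = A (last u s) - A u.
Proof.
elim: s u => [|v s ih] u /=; first by rewrite big_ord0 subrr.
by rewrite big_ord_recl /= ih; ring.
Qed.

Lemma mesh_lt (s : seq R) (delta : R) k : mesh s < delta -> (k < size s)%N ->
  nth 0 s k - nth 0 (0 :: s) k < delta.
Proof.
move=> sd ks; apply: le_lt_trans sd; rewrite /mesh.
exact: (le_bigmax _ (fun k : 'I_(size s) => nth 0 s k - nth 0 (0 :: s) k) (Ordinal ks)).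
Qed.

(* [W] plays the role of a total variation: the local errors add up to at most
   e (W t - W 0). *)
Lemma square_sum_cvg dO (Omega : measurableType dO) l (X : R -> Omega -> 'rV[R]_l) (A W : R -> R) T t
    (pi : nat -> seq R) omega :
  (forall e, 0 < e -> exists2 delta, 0 < delta & forall u v,
     0 <= u -> u <= v -> v <= T -> v - u < delta ->
     `|enorm2 (X v omega - X u omega) - (A v - A u)| <= e * (W v - W u)) ->
  0 <= t <= T -> (forall k, itv_partition 0 t (pi k)) ->
  mesh (pi k) @[k --> \oo] --> 0 ->
  square_sum X (pi k) omega @[k --> \oo] --> enorm2 (X 0 omega) + (A t - A 0).
Proof.
move=> XA /andP[t0 tT] pip mpi.
apply/cvgrPdist_lt => e e0.
(* Local tolerance e / c gives a total error of at most (e / c) (W t - W 0), which is less than e;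
   the added 1 keeps c positive. *)
pose c := `|W t - W 0| + 1.
have c0 : 0 < c by rewrite ltr_wpDl.
have [delta d0 XAd] := XA _ (divr_gt0 e0 c0).
have : \forall k \near \oo, mesh (pi k) < delta.
  by move/cvgrPdist_lt : mpi => /(_ _ d0); apply: filterS => k;
     rewrite sub0r normrN; exact: le_lt_trans (ler_norm _).
apply: filterS => k mk.
have [pk /eqP lk] := pip k.
have := @partition_sum (fun u v => enorm2 (X v omega - X u omega) - (A v - A u)) W
  (e / c) delta T XAd (pi k) 0 (lexx _) pk _ (fun j => mesh_lt mk).
rewrite lk tT => /(_ isT); rewrite sumrB.
rewrite telescope_nth lk.
move=> h; rewrite distrC /square_sum [X in `|X|](_ : _ =
  \sum_(j < size (pi k)) enorm2 (X (nth 0 (pi k) j) omega - X (nth 0 (0 :: pi k) j) omega)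
   - (A t - A 0)); last by ring.
apply: (le_lt_trans h); rewrite -ltr_pdivlMl ?divr_gt0// invf_div divfK ?gt_eqF//.
by rewrite /c (le_lt_trans (ler_norm _))// ltrDl.
Qed.

End PartitionSums.

(** * Iterated integrals over the strips ]0, t] x X *)

Section StripFubini.
Context {R : realType} {dX} {X : measurableType dX}
  (nu : {finite_measure set X -> \bar R}).
Local Notation mR := (measurableTypeR R).
Local Notation strip t := (`]0%R, t] `*` setT : set (mR * X)%type).
Local Notation lnu := (@lebesgue_measure R \x nu)%E.

(** The inner [Rintegral] takes the default value 0 where the integral of a section is infinite. By
    Fubini this concerns a null set of times, so the iterated integral in [compensated_integral] is
    the integral for the product measure. *)
Lemma Rintegral_strip (phi : mR * X -> R) t :
  measurable_fun setT phi -> lnu.-integrable (strip t) (EFin \o phi) ->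
  \int[lebesgue_measure]_(s in `]0, t]) (\int[nu]_x phi (s, x)) =
  \int[lnu]_(z in strip t) phi z.
Proof.
move=> mphi ip; have ms : measurable (strip t) by exact: measurable_strip.
have ip' : lnu.-integrable setT ((EFin \o phi) \_ (strip t)) by have [+ _] := integrable_mkcond (mu := lnu) (EFin \o phi) ms; apply.
rewrite /Rintegral; congr fine.
rewrite [RHS]integral_mkcond -integral12_prod_meas1// [LHS]integral_mkcond.
have E s : fubini_F nu ((EFin \o phi) \_ (strip t)) s =
    if s \in `]0, t]%classic then (\int[nu]_x (phi (s, x))%:E)%E else 0%E.
  rewrite /fubini_F; case: ifPn => st.
    apply: eq_integral => x _; rewrite patchE mem_set//; split => //.
    exact/set_mem.
  apply: integral0_eq => x _; rewrite patchE memNset// => -[/= st' _].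
  by move/negP: st; apply; exact/mem_set.
apply: ae_eq_integral => //.
- apply/(measurable_restrictT _ (measurable_itv `]0, t])); apply: measurable_funTS.
  apply/measurable_EFinP; apply: measurableT_comp => //.
  have mEphi : measurable_fun setT (EFin \o phi) by exact/measurable_EFinP.
  under eq_fun do rewrite integralE.
  have mp := measurable_funepos mEphi; have mn := measurable_funeneg mEphi.
  apply: emeasurable_funB.
    have := measurable_fun_fubini_tonelli_F (m2 := nu) _ mp (funepos_ge0 _).
    congr (measurable_fun _ _); apply/funext => s.
    by apply: eq_integral => x _; rewrite !funeposE.
  have := measurable_fun_fubini_tonelli_F (m2 := nu) _ mn (funeneg_ge0 _).
  congr (measurable_fun _ _); apply/funext => s.
  by apply: eq_integral => x _; rewrite !funenegE.
- exact: measurable_fubini_F ip'.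
(* For almost every s the section is integrable, and [fine] loses nothing there. *)
- apply: filterS (ae_integrable1 ip') => s /= is' _.
  rewrite E patchE; case: ifPn => st //.
  rewrite fineK//; apply: integrable_fin_num => //.
  move: is'; congr (_.-integrable _ _); apply/funext => x /=.
  by rewrite patchE mem_set//; split => //; exact/set_mem.
Qed.

Lemma strip_lty t : (lnu (strip t) < +oo)%E.
Proof.
rewrite [ltLHS](_ : _ = lebesgue_measure `]0%R, t] * nu setT)%E; last first.
  exact: product_measure1E.
rewrite lebesgue_measure_itv/= -[nu setT]fineK ?fin_num_measure//.
by case: ifP => _; rewrite -?EFinD -EFinM ltry.
Qed.

Lemma ge0_integral_strip (phi : mR * X -> \bar R) t :
  measurable_fun setT phi -> (forall z, 0 <= phi z)%E ->
  (\int[lebesgue_measure]_(s in `]0%R, t]) \int[nu]_x phi (s, x) =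
   \int[lnu]_(z in strip t) phi z)%E.
Proof.
move=> mphi phi0; have ms : measurable (strip t) by exact: measurable_strip.
rewrite [RHS]integral_mkcond fubini_tonelli1//; last 2 first.
- by apply/(measurable_restrictT _ ms); exact: measurable_funTS.
- by move=> z; rewrite patchE; case: ifP.
rewrite [LHS]integral_mkcond; apply: eq_integral => s _; rewrite patchE /fubini_F.
case: ifPn => st; apply/esym.
  apply: eq_integral => x _; rewrite patchE mem_set//; split => //.
  exact/set_mem.
apply: integral0_eq => x _; rewrite patchE memNset// => -[/= st' _].
by move/negP: st; apply; exact/mem_set.
Qed.

End StripFubini.

(** * Vector fields *)

Section VectorFields.
Context {R : realType} {dO dX : measure_display} {Omega : measurableType dO}
  {X : measurableType dX} (P : probability Omega R) (d l : nat) (T : R)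
  (B : R -> Omega -> 'rV[R]_d) (pp : Omega -> R -> option X)
  (nu : {finite_measure set X -> \bar R}).

Local Notation F := (filtration P B pp).
Local Notation mR := (measurableTypeR R).
Local Notation PP := (predictableType P T B pp).
Local Notation mark := (@mark _ _ _ _ _ P _ T B pp).
Local Notation strip t := (`]0%R, t] `*` setT : set (mR * X)%type).
Local Notation lnu := (@lebesgue_measure R \x nu)%E.
Local Notation jump_sum := (@jump_sum _ _ _ _ _ P _ T B pp).
Local Notation drift := (@drift _ _ _ _ _ P _ T B pp nu).
Local Notation L1_field := (@L1_field _ _ _ _ _ P _ T B pp nu).
Local Notation compensated := (@compensated _ _ _ _ _ P _ T B pp nu).

Hypothesis hT : 0 < T.
Hypothesis hpt : point_process pp T.
Hypothesis hF : forall t, t <= T -> F t `<=` measurable.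
Hypothesis hnu : compensator P T F pp nu.

Let S : set PP := (`]0, T] `*` setT) `*` setT.

Definition field_coord (f : R -> Omega -> X -> 'rV[R]_l) (i : 'I_l) : PP -> R :=
  (fun z : PP => f z.1.1 z.1.2 z.2 0 i) \_ S.

Definition field_norm2 (f : R -> Omega -> X -> 'rV[R]_l) : PP -> R :=
  (fun z : PP => enorm2 (f z.1.1 z.1.2 z.2)) \_ S.

Definition field_norm (f : R -> Omega -> X -> 'rV[R]_l) : PP -> R :=
  (fun z : PP => enorm (f z.1.1 z.1.2 z.2)) \_ S.

Implicit Types f : R -> Omega -> X -> 'rV[R]_l.

Lemma enorm2_ge0 (x : 'rV[R]_l) : 0 <= enorm2 x.
Proof. by apply: sumr_ge0 => i _; exact: sqr_ge0. Qed.

Lemma enorm_ge0 (x : 'rV[R]_l) : 0 <= enorm x.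
Proof. exact: sqrtr_ge0. Qed.

Lemma coord_le_enorm (x : 'rV[R]_l) i : `|x 0 i| <= enorm x.
Proof.
rewrite -sqrtr_sqr ler_wsqrtr// /enorm2 (bigD1 i)//= lerDl.
by apply: sumr_ge0 => j _; exact: sqr_ge0.
Qed.

Definition measurable_field f := forall i, measurable_fun setT (field_coord f i).

Lemma predictable_measurable_field f : predictable_field T F f -> measurable_field f.
Proof.
move=> pf i; have mS : measurable S.
  by apply: measurable_rectangle; rewrite ?lexx ?ltW//; exact: filtrationT.
apply/(measurable_restrictT _ mS).
exact: predictable_field_measurable.
Qed.

Lemma field_norm2E f z : field_norm2 f z = \sum_i field_coord f i z ^+ 2.
Proof.
rewrite /field_norm2 /field_coord patchE; case: ifPn => Sz.
  by apply: eq_bigr => i _; rewrite patchE Sz.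
by rewrite big1// => i _; rewrite patchE (negbTE Sz) expr0n.
Qed.

Lemma field_normE f z : field_norm f z = Num.sqrt (field_norm2 f z).
Proof.
by rewrite /field_norm2 /field_norm !patchE; case: ifPn => // _; rewrite sqrtr0.
Qed.

Lemma measurable_field_norm2 f : measurable_field f ->
  measurable_fun setT (field_norm2 f).
Proof.
move=> pf; rewrite (_ : field_norm2 f = fun z => \sum_i field_coord f i z ^+ 2); last first.
  by apply/funext => z; exact: field_norm2E.
apply: measurable_sum => i; apply: measurable_funX.
exact: pf.
Qed.

Lemma measurable_field_norm f : measurable_field f ->
  measurable_fun setT (field_norm f).
Proof.
move=> pf; rewrite (_ : field_norm f = fun z => Num.sqrt (field_norm2 f z)); last first.
  by apply/funext => z; exact: field_normE.
apply: measurableT_comp; last exact: measurable_field_norm2.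
by apply: continuous_measurable_fun; exact: sqrt_continuous.
Qed.

Lemma field_norm_ge0 f z : 0 <= field_norm f z.
Proof. by rewrite field_normE sqrtr_ge0. Qed.

Lemma field_coord_le_norm f i z : `|field_coord f i z| <= `|field_norm f z|.
Proof.
rewrite (ger0_norm (field_norm_ge0 f z)) /field_coord /field_norm !patchE.
by case: ifPn => [_|_]; [exact: coord_le_enorm|rewrite normr0].
Qed.

Definition integrable_field f := measurable_field f /\ L1_field (field_norm f).

Lemma L1_field_coord f i : integrable_field f -> L1_field (field_coord f i).
Proof.
move=> [pf fL]; apply: (L1_field_le hT hF (pf i) _ fL).
exact: field_coord_le_norm.
Qed.

(** The paths on which sums over the points and drifts take their intended values; [count_integral]
    and [drift] may be default values elsewhere. *)
Definition regular f omega := finite_set (jump_times pp omega) /\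
  forall i, lnu.-integrable (strip T) (fun z => (field_coord f i (mark omega z))%:E).

Lemma ae_regular f : integrable_field f -> {ae P, forall omega, regular f omega}.
Proof.
move=> fL; have : {ae P, forall omega i,
    lnu.-integrable (strip T) (fun z => (field_coord f i (mark omega z))%:E)}.
  apply: filter_forall => i.
  by apply: (ae_integrable_L1_field hT hF); exact: L1_field_coord.
by apply: filterS2 (ae_finite_jumps hpt hnu) => omega; split.
Qed.

Let jumpsT omega : jump_times pp omega `<=` `]0, T].
Proof. by have [] := hpt.1 omega. Qed.

Lemma field_patchE (h : R -> Omega -> X -> R) omega (z : mR * X) :
  0 < z.1 <= T ->
  ((fun z : PP => h z.1.1 z.1.2 z.2) \_ S) (mark omega z) = h z.1 omega z.2.
Proof. by move=> zT; rewrite patchE mem_set// /S /mark /=; rewrite in_itv. Qed.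

Lemma count_integral_jump_sum (h : R -> Omega -> X -> R) t omega :
  finite_set (jump_times pp omega) ->
  count_integral pp h t omega = jump_sum ((fun z : PP => h z.1.1 z.1.2 z.2) \_ S) t omega.
Proof.
move=> Jf; rewrite (count_integralE _ _ Jf (@jumpsT omega)) /jump_sum.
rewrite big_seq [RHS]big_seq; apply: eq_bigr => z.
rewrite mem_filter => /andP[_ /(points_gt0 (@jumpsT omega)) zT].
by rewrite (field_patchE h).
Qed.

Lemma count_integral_coord f t omega i : finite_set (jump_times pp omega) ->
  count_integral pp f t omega 0 i = jump_sum (field_coord f i) t omega.
Proof.
move=> Jf; rewrite -(count_integral_jump_sum (fun s w x => f s w x 0 i) _ Jf).
by rewrite !(count_integralE _ _ Jf (@jumpsT omega)) summxE.
Qed.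

Lemma compensated_integralE f t omega i : measurable_field f ->
  regular f omega -> 0 <= t <= T ->
  compensated_integral pp nu f t omega 0 i = compensated (field_coord f i) t omega.
Proof.
move=> pf rf /andP[t0 tT]; rewrite /compensated_integral !mxE.
rewrite (count_integral_coord _ _ _ rf.1); congr (_ - _).
have subT : strip t `<=` strip T.
  by move=> -[r x] /=; rewrite !in_itv/= => -[/andP[-> rt] _]; rewrite (le_trans rt).
rewrite /drift -[RHS]/(\int[lnu]_(z in strip t) field_coord f i (mark omega z))%R.
rewrite -Rintegral_strip.
- apply: eq_Rintegral => s /set_mem/=; rewrite in_itv/= => /andP[s0 st].
  apply: eq_Rintegral => x _; apply/esym.
  apply: (field_patchE (fun s w x => f s w x 0 i) omega (z := (s, x))).
  by rewrite /= s0 (le_trans st).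
- by apply: measurable_comp_mark; exact: pf.
- apply: (integrableS _ _ subT); [exact: measurable_strip..|].
  exact: rf.2.
Qed.

End VectorFields.

(** * One-sided limits and squared increments of a compensated path *)

Section Paths.
Context {R : realType} {dO dX : measure_display} {Omega : measurableType dO}
  {X : measurableType dX} (P : probability Omega R) (d : nat) (T : R)
  (B : R -> Omega -> 'rV[R]_d) (pp : Omega -> R -> option X)
  (nu : {finite_measure set X -> \bar R}).

Local Notation mR := (measurableTypeR R).
Local Notation PP := (predictableType P T B pp).
Local Notation mark := (@mark _ _ _ _ _ P _ T B pp).
Local Notation strip t := (`]0%R, t] `*` setT : set (mR * X)%type).
Local Notation lnu := (@lebesgue_measure R \x nu)%E.
Local Notation jump_sum := (@jump_sum _ _ _ _ _ P _ T B pp).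
Local Notation drift := (@drift _ _ _ _ _ P _ T B pp nu).
Local Notation compensated := (@compensated _ _ _ _ _ P _ T B pp nu).

Variables (g : PP -> R) (omega : Omega).
Hypothesis gi : lnu.-integrable (strip T) (fun z => (g (mark omega z))%:E).

Definition mark_at (h : PP -> R) (s : R) : R :=
  if pp omega s is Some x then h (mark omega (s, x)) else 0.

Lemma jump_sum_step (h : PP -> R) t :
  jump_sum h t omega = step (fset_set (jump_times pp omega)) (mark_at h) t.
Proof.
rewrite /jump_sum /points_upto big_filter.
rewrite (eq_bigr (fun z => h (mark omega (z.1, z.2)))) => [|[]//].
exact: (big_points _ _ (fun s => s <= t) (fun s x => h (mark omega (s, x)))).
Qed.

Let gni : lnu.-integrable (strip T) (fun z => `|g (mark omega z)|%:E).
Proof. exact: (integrable_norm gi). Qed.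

(** Absolute continuity of the integral, since ]u, v] x X has mass (v - u) nu(X), uniformly in the
    position of the interval. *)
Lemma drift_modulus e : 0 < e -> exists2 delta, 0 < delta & forall u v,
  0 <= u -> u <= v -> v <= T -> v - u < delta ->
  drift (fun z => `|g z|) v omega - drift (fun z => `|g z|) u omega < e.
Proof.
move=> e0; have mT : measurable (strip T) by exact: measurable_strip.
have giT : lnu.-integrable setT (EFin \o ((g \o mark omega) \_ (strip T))).
  rewrite -restrict_EFin.
  by have [+ _] := integrable_mkcond (mu := lnu) (EFin \o (g \o mark omega)) mT; apply.
have [delta [d0 dA]] := integral_normr_continuous giT e0.
(* The added 1 allows division by c even when nu is zero. *)
pose c := fine (nu setT) + 1.
have c0 : 0 < c by rewrite ltr_wpDl// fine_ge0.
exists (delta / c); first exact: divr_gt0.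
move=> u v u0 uv vT vu; rewrite drift_sub// ?u0//.
have muv : measurable (`]u, v] `*` setT : set (mR * X)%type) by exact: measurableX.
apply: le_lt_trans (dA _ muv _); last first.
  rewrite [ltLHS](_ : _ = lebesgue_measure `]u, v] * nu setT)%E; last first.
    exact: product_measure1E.
  rewrite lebesgue_measure_itv/= lte_fin.
  case: ifPn => _; last by rewrite mul0e lte_fin.
  rewrite -[nu setT]fineK ?fin_num_measure// -EFinD -EFinM lte_fin.
  rewrite ltr_pdivlMr// in vu; apply: le_lt_trans vu.
  by rewrite ler_wpM2l ?subr_ge0// /c lerDl.
rewrite le_eqVlt; apply/orP; left; apply/eqP; apply: eq_Rintegral => z /set_mem zuv.
by rewrite patchE mem_set//; exact: sub_strip zuv.
Qed.

Lemma drift_increment_norm u v : 0 <= u -> u <= v -> v <= T ->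
  `|drift g v omega - drift g u omega| <=
  drift (fun z => `|g z|) v omega - drift (fun z => `|g z|) u omega.
Proof.
move=> u0 uv vT; rewrite !drift_sub// ?u0//.
apply: le_normr_Rintegral; first exact: measurableX.
apply: (integrableS _ _ _ gi); [exact: measurable_strip|exact: measurableX|].
exact: sub_strip.
Qed.

Lemma drift_right t : 0 <= t < T ->
  drift g s omega @[s --> t^'+] --> drift g t omega.
Proof.
move=> /andP[t0 tT]; apply/cvgrPdist_lt => e e0.
have [delta d0 dd] := drift_modulus e0.
near=> s; rewrite distrC.
have ts : t <= s by near: s; exact: nbhs_right_ge.
have sT : s <= T by near: s; exact: nbhs_right_le.
apply: (le_lt_trans (drift_increment_norm t0 ts sT)); apply: dd => //.
by rewrite ltrBlDl; near: s; apply: nbhs_right_lt; rewrite ltrDl.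
Unshelve. all: by end_near. Qed.

Lemma drift_left t : 0 < t <= T ->
  drift g s omega @[s --> t^'-] --> drift g t omega.
Proof.
move=> /andP[t0 tT]; apply/cvgrPdist_lt => e e0.
have [delta d0 dd] := drift_modulus e0.
near=> s.
have st : s <= t by near: s; exact: nbhs_left_le.
have s0 : 0 <= s by near: s; exact: nbhs_left_ge.
apply: (le_lt_trans (drift_increment_norm s0 st tT)); apply: dd => //.
rewrite ltrBlDl -ltrBlDr; near: s; apply: nbhs_left_gt.
by rewrite ltrBlDr ltrDl.
Unshelve. all: by end_near. Qed.

Lemma compensated_right t : 0 <= t < T ->
  compensated g s omega @[s --> t^'+] --> compensated g t omega.
Proof.
move=> tT; rewrite /compensated jump_sum_step; under eq_fun do rewrite jump_sum_step.
apply: cvgB; [exact: step_right_continuous|exact: drift_right].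
Qed.

(** The drift is continuous, so only the sum contributes to the jump; jump times are listed without
    repetition, so at most one term has time t. *)
Lemma compensated_left t : 0 < t <= T -> finite_set (jump_times pp omega) ->
  compensated g s omega @[s --> t^'-] --> compensated g t omega - mark_at g t.
Proof.
move=> tT Jf; set l := (X in _ --> X).
have -> : l = \sum_(s <- fset_set (jump_times pp omega) | s < t) mark_at g s -
    drift g t omega.
  have := @step_jump _ (fset_set (jump_times pp omega)) (mark_at g) t (finmap.fset_uniq _).
  rewrite -jump_sum_step (_ : (if _ then _ else _) = mark_at g t); last first.
    case: ifPn => //; rewrite in_fset_set// /mark_at.
    case E : (pp omega t) => [x|//] /negP[]; apply/mem_set.
    by exists x.
  by rewrite /l /compensated => <-; ring.
rewrite /compensated; under eq_fun do rewrite jump_sum_step.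
by apply: cvgB; [exact: step_left_limit|exact: drift_left].
Qed.

(* For an increment J of the sum and C of the drift, (J - C)^2 - J^2 = C (C - 2 J), and
   C is uniformly small on short intervals. *)
Lemma compensated_square e : 0 < e -> exists2 delta, 0 < delta & forall u v,
  0 <= u -> u <= v -> v <= T -> v - u < delta ->
  `|(compensated g v omega - compensated g u omega) ^+ 2 -
    (jump_sum (fun z => g z ^+ 2) v omega - jump_sum (fun z => g z ^+ 2) u omega)| <=
  e * ((drift (fun z => `|g z|) v omega + 2 * jump_sum (fun z => `|g z|) v omega) -
       (drift (fun z => `|g z|) u omega + 2 * jump_sum (fun z => `|g z|) u omega)).
Proof.
move=> e0; have [d1 d10 H1] := drift_modulus e0.
have [d2 d20 H2] := step_square (finmap.fset_uniq (fset_set (jump_times pp omega))).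
exists (Num.min d1 d2); first by rewrite lt_min d10.
move=> u v u0 uv vT; rewrite lt_min => /andP[vu1 vu2].
have {H2} := H2 (mark_at g) _ _ uv vu2.
rewrite (_ : (fun s => mark_at g s ^+ 2) = mark_at (fun z => g z ^+ 2)); last first.
  by apply/funext => s; rewrite /mark_at; case: (pp omega s) => //; rewrite expr0n.
rewrite -!jump_sum_step => H2.
have := step_norm (fset_set (jump_times pp omega)) (mark_at g) uv.
rewrite (_ : (fun s => `|mark_at g s|) = mark_at (fun z => `|g z|)); last first.
  by apply/funext => s; rewrite /mark_at; case: (pp omega s) => //; rewrite normr0.
rewrite -!jump_sum_step.
have {H1} := H1 _ _ u0 uv vT vu1.
have := drift_increment_norm u0 uv vT.
move: H2; rewrite /compensated.
set C := drift g v omega - drift g u omega.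
set J := jump_sum g v omega - jump_sum g u omega => <-.
set H := _ - _; set K := _ - _ => CH He JK.
rewrite (_ : _ - J ^+ 2 = C * (C - 2 * J)); last by rewrite /C /J; ring.
rewrite normrM (_ : e * _ = e * (H + 2 * K)); last by rewrite /H /K; ring.
(* |C| is at most e, and |C - 2 J| is at most H + 2 K, the increment of the nondecreasing function
   on the right-hand side. *)
apply: ler_pM => //; first by rewrite (le_trans CH)// ltW.
rewrite (le_trans (ler_normB _ _))// lerD// normrM ger0_norm// ler_pM2l//.
Qed.

End Paths.

(** * Explicit partitions and convergence in probability *)

Section Convergence.
Context {R : realType}.

Lemma cvg_coord {T : Type} (G : set_system T) {FG : Filter G} l (f : T -> 'rV[R]_l)
    (a : 'rV[R]_l) :
  (forall i, f s 0 i @[s --> G] --> a 0 i) -> f s @[s --> G] --> a.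
Proof.
move=> fa; apply/cvg_ballP => e e0.
have : \forall s \near G, forall i, ball (a 0 i) e (f s 0 i).
  by apply: filter_forall => i; move/cvg_ballP: (fa i) => /(_ e e0).
apply: filterS => s h; split => // i j.
by rewrite (ord1 i).
Qed.

(** A concrete sequence of partitions with vanishing mesh, along which two quadratic variations are
    compared. The index is shifted by one because an [itv_partition] lists its right endpoints and
    leaves out the origin. *)
Definition uniform_partition (t : R) (n : nat) : seq R :=
  [seq t * (j.+1)%:R / n.+1%:R | j <- iota 0 n.+1].

Lemma nth_uniform_partition t n k : (k < n.+1)%N ->
  nth 0 (uniform_partition t n) k = t * k.+1%:R / n.+1%:R.
Proof. by move=> kn; rewrite (nth_map 0%N) ?size_iota// nth_iota. Qed.

Lemma nth_cons_uniform_partition t n k : (k <= n.+1)%N ->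
  nth 0 (0 :: uniform_partition t n) k = t * k%:R / n.+1%:R.
Proof.
by case: k => [|k] kn /=; [rewrite mulr0 mul0r|rewrite nth_uniform_partition].
Qed.

Lemma uniform_partitionP t n : 0 < t -> itv_partition 0 t (uniform_partition t n).
Proof.
move=> t0; split.
- apply/(pathP 0) => k; rewrite size_map size_iota => kn.
  rewrite nth_cons_uniform_partition 1?ltnW// nth_uniform_partition//.
  by rewrite ltr_pM2r ?invr_gt0 ?ltr0n// ltr_pM2l// ltr_nat.
- rewrite (last_nth 0) size_map size_iota nth_cons_uniform_partition//.
  by rewrite mulfK// pnatr_eq0.
Qed.

Lemma mesh_uniform_partition t n : 0 < t -> mesh (uniform_partition t n) <= t / n.+1%:R.
Proof.
move=> t0; apply/bigmax_leP; split; first by rewrite divr_ge0// ltW.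
move=> [k /=]; rewrite size_map size_iota => kn _.
rewrite nth_cons_uniform_partition 1?ltnW// nth_uniform_partition//.
by rewrite -mulrBl -mulrBr -natrB// subSnn mulr1.
Qed.

Lemma mesh_uniform_partition_cvg t : 0 < t ->
  mesh (uniform_partition t n) @[n --> \oo] --> 0.
Proof.
move=> t0; apply: (squeeze_cvgr (f := fun=> 0) (h := fun n => t / n.+1%:R)).
- near=> n; rewrite mesh_uniform_partition// andbT /mesh.
  exact: bigmax_ge_id.
- exact: cvg_cst.
- rewrite -[X in _ --> X](mulr0 t); apply: cvgM; first exact: cvg_cst.
  exact: cvg_harmonic.
Unshelve. all: by end_near. Qed.

Context {dO} {Omega : measurableType dO} (P : probability Omega R).

(** Dominated convergence for the indicators of [D k], which are eventually 0 at almost every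
    omega. *)
Lemma ae_cvg_probability (Y : nat -> Omega -> R) :
  (forall k, measurable_fun setT (Y k)) ->
  {ae P, forall omega, Y k omega @[k --> \oo] --> 0} ->
  forall eta, 0 < eta ->
    P [set omega | eta < `|Y k omega|] @[k --> \oo] --> 0%E.
Proof.
move=> mY Y0 eta eta0.
pose D k := [set omega | eta < `|Y k omega|].
have mD k : measurable (D k).
  rewrite (_ : D k = setT `&` (Num.norm \o Y k) @^-1` `]eta, +oo[).
    by apply: measurableT_comp => //; exact: measurable_itv.
  by rewrite setTI; apply/seteqP; split => w; rewrite /D/= in_itv/= andbT.
rewrite (_ : (fun k => _) = fun k => (\int[P]_omega (\1_(D k) omega)%:E)%E); last first.
  by apply/funext => k; rewrite integral_indic// setIT.
have -> : 0%E = (\int[P]_omega (cst 0%E omega))%E by rewrite integral0.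
have := @dominated_convergence _ _ _ P setT measurableT
  (fun k omega => (\1_(D k) omega)%:E) (cst 0%E) (cst 1%E).
move=> [] //.
- by move=> k; apply/measurable_EFinP; exact: measurable_indic.
- apply: filterS Y0 => omega Y0 _; apply: cvg_near_cst.
  move/cvgrPdist_lt : Y0 => /(_ eta eta0); apply: filterS => k.
  rewrite sub0r normrN => Yk; rewrite indicE memNset// /D/= => /ltW.
  by rewrite leNgt Yk.
- exact: finite_measure_integrable_cst.
- by apply: aeW => omega k _; rewrite /= lee_fin ger0_norm.
Qed.

(** If |A - A'| > 2 eta, then Y k is farther than eta from A or from A', an event whose probability
    tends to 0. The union over eta = 1 / (n + 1) covers the set where A and A' differ. *)
Lemma limit_in_probability_unique (Y : nat -> Omega -> R) (A A' : Omega -> R) :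
  (forall k, measurable_fun setT (Y k)) ->
  measurable_fun setT A -> measurable_fun setT A' ->
  (forall eta, 0 < eta -> P [set omega | eta < `|Y k omega - A omega|] @[k --> \oo] --> 0%E) ->
  (forall eta, 0 < eta -> P [set omega | eta < `|Y k omega - A' omega|] @[k --> \oo] --> 0%E) ->
  {ae P, forall omega, A omega = A' omega}.
Proof.
move=> mY mA mA' YA YA'.
have mD (h : Omega -> R) eta : measurable_fun setT h -> measurable [set omega | eta < `|h omega|].
  move=> mh; rewrite (_ : [set _ | _] = setT `&` (Num.norm \o h) @^-1` `]eta, +oo[).
    by apply: measurableT_comp => //; exact: measurable_itv.
  by rewrite setTI; apply/seteqP; split => w /=; rewrite in_itv/= andbT.
have D0 eta : 0 < eta -> P [set omega | eta + eta < `|A omega - A' omega|] = 0%E.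
  move=> eta0; apply/eqP; rewrite -measure_le0.
  have h : (P [set omega | (eta < `|Y k omega - A omega|)%R] +
      P [set omega | (eta < `|Y k omega - A' omega|)%R])%E @[k --> \oo] --> 0%E.
    by rewrite -[X in _ --> X]adde0; apply: cvgeD => //; [exact: YA|exact: YA'].
  apply: (cvge_to_ge h); apply: nearW => k.
  have mkA := mD _ eta (measurable_funB (mY k) mA).
  have mkA' := mD _ eta (measurable_funB (mY k) mA').
  apply: le_trans (measureU2 _ mkA mkA'); apply: le_measure.
  - by apply/mem_set; exact: (mD _ _ (measurable_funB mA mA')).
  - by apply/mem_set; exact: measurableU.
  move=> omega /= h1; have [h2|h2] := ltP eta `|Y k omega - A omega|; first by left.
  right; rewrite -(ltrD2l eta); apply: (lt_le_trans h1).
  rewrite (_ : A omega - A' omega = (Y k omega - A' omega) - (Y k omega - A omega)); last by ring.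
  by rewrite (le_trans (ler_normB _ _))// addrC lerD2r.
have : P.-negligible (\bigcup_n [set omega | n.+1%:R^-1 + n.+1%:R^-1 < `|A omega - A' omega|]).
  apply: negligible_bigcup => n; apply/negligibleP.
    exact: (mD _ _ (measurable_funB mA mA')).
  by apply: D0; rewrite invr_gt0.
apply: negligibleS => omega /= AA'.
have d0 : 0 < `|A omega - A' omega| by rewrite normr_gt0 subr_eq0; apply/eqP.
have [n hn] : exists n, n.+1%:R^-1 < `|A omega - A' omega| / 2.
  have d20 : 0 < `|A omega - A' omega| / 2 by rewrite divr_gt0.
  have /cvgrPdist_lt/(_ _ d20)[n _ /(_ n (leqnn n))] := @cvg_harmonic R.
  rewrite sub0r normrN ger0_norm ?invr_ge0// => ?; by exists n.
exists n => //; rewrite /mkset; move: hn; rewrite ltr_pdivlMr//.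
by rewrite mulrDr mulr1.
Qed.

End Convergence.

(** * Cadlag paths, jumps, martingale property and quadratic variation of the integral *)

Section Process.
Context {R : realType} {dO dX : measure_display} {Omega : measurableType dO}
  {X : measurableType dX} (P : probability Omega R) (d l : nat) (T : R)
  (B : R -> Omega -> 'rV[R]_d) (pp : Omega -> R -> option X)
  (nu : {finite_measure set X -> \bar R}).

Local Notation F := (filtration P B pp).
Local Notation mR := (measurableTypeR R).
Local Notation PP := (predictableType P T B pp).
Local Notation mark := (@mark _ _ _ _ _ P _ T B pp).
Local Notation strip t := (`]0%R, t] `*` setT : set (mR * X)%type).
Local Notation jump_sum := (@jump_sum _ _ _ _ _ P _ T B pp).
Local Notation drift := (@drift _ _ _ _ _ P _ T B pp nu).
Local Notation compensated := (@compensated _ _ _ _ _ P _ T B pp nu).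
Local Notation L1_field := (@L1_field _ _ _ _ _ P _ T B pp nu).
Local Notation field_coord := (@field_coord _ _ _ _ _ P _ l T B pp).
Local Notation field_norm2 := (@field_norm2 _ _ _ _ _ P _ l T B pp).
Local Notation field_norm := (@field_norm _ _ _ _ _ P _ l T B pp).

Hypothesis hT : 0 < T.
Hypothesis hpt : point_process pp T.
Hypothesis hF : forall t, t <= T -> F t `<=` measurable.
Hypothesis hnu : compensator P T F pp nu.

Variables (f : R -> Omega -> X -> 'rV[R]_l) (Y : R -> Omega -> 'rV[R]_l).
Hypothesis fL : integrable_field P T B pp nu f.
Hypothesis hY : {ae P, forall omega, forall t, 0 <= t <= T ->
  Y t omega = compensated_integral pp nu f t omega}.

(** Y is only assumed to agree almost surely with the path by path integral, so that the results
    also apply to a difference of two integrals, which is the integral of the difference of the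
    fields off a null set. *)
Definition good omega := regular P T B pp nu f omega /\ forall t i, 0 <= t <= T ->
  Y t omega 0 i = compensated (field_coord f i) t omega.

Lemma ae_good : {ae P, forall omega, good omega}.
Proof.
apply: filterS2 (ae_regular hT hpt hF hnu fL) hY => omega rf Yf; split => // t i tT.
by rewrite Yf// (compensated_integralE hpt i fL.1 rf).
Qed.

Lemma good_right omega t : good omega -> 0 <= t < T ->
  Y s omega @[s --> t^'+] --> Y t omega.
Proof.
move=> [rf Yf] /[dup] tT' /andP[t0 tT]; apply: cvg_coord => i.
rewrite Yf ?t0 ?ltW//.
have := compensated_right (rf.2 i) tT'.
apply: cvg_trans; apply: near_eq_cvg; near=> s; rewrite Yf//.
apply/andP; split.
  by rewrite (le_trans t0)//; near: s; exact: nbhs_right_ge.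
by near: s; exact: nbhs_right_le.
Unshelve. all: by end_near. Qed.

Lemma mark_at_coord omega t i : 0 < t <= T ->
  mark_at omega (field_coord f i) t = at_jump pp f t omega 0 i.
Proof.
move=> tT; rewrite /mark_at /at_jump; case: (pp omega t) => [x|]; last by rewrite mxE.
exact: (field_patchE P B pp (fun s w x => f s w x 0 i) omega (z := (t, x))).
Qed.

Lemma good_left omega t : good omega -> 0 < t <= T ->
  Y s omega @[s --> t^'-] --> Y t omega - at_jump pp f t omega.
Proof.
move=> [rf Yf] /[dup] tT' /andP[t0 tT]; apply: cvg_coord => i.
rewrite !mxE -mark_at_coord// Yf ?tT ?ltW//.
have := compensated_left (rf.2 i) tT' rf.1.
apply: cvg_trans; apply: near_eq_cvg; near=> s; rewrite Yf//.
apply/andP; split.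
  by near: s; exact: nbhs_left_ge.
by rewrite (le_trans _ tT)//; near: s; exact: nbhs_left_le.
Unshelve. all: by end_near. Qed.

Lemma cadlag_process : cadlag P T Y.
Proof.
apply: filterS ae_good => omega gw; split => t tT; first exact: good_right.
by apply/cvg_ex; eexists; exact: good_left.
Qed.

Lemma jump_process : {ae P, forall omega, forall t, 0 < t <= T ->
  path_jump (fun s => Y s omega) t = at_jump pp f t omega}.
Proof.
apply: filterS ae_good => omega gw t /[dup] tT /andP[t0 _].
rewrite /path_jump /left_lim leNgt t0/=.
have -> := cvg_lim (@norm_hausdorff _ _) (good_left gw tT).
by rewrite subKr.
Qed.

Lemma martingale_process : martingale P T F Y.
Proof.
move=> i; apply: (rmartingale_compensated hT hpt hF hnu (g := field_coord f i)).
  exact: L1_field_coord.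
by move=> t tT; apply: filterS ae_good => omega [_ /(_ t i tT)].
Qed.

Lemma jump_sum0 (g : PP -> R) omega : jump_sum g 0 omega = 0.
Proof.
rewrite /jump_sum big_seq big1// => z; rewrite mem_filter => /andP[z0].
by move=> /(points_gt0 (hpt.1 omega).2)/andP[]; rewrite ltNge z0.
Qed.

Lemma drift0 (g : PP -> R) omega : drift g 0 omega = 0.
Proof.
rewrite /drift (_ : strip 0 = set0) ?integral_set0//.
by apply/seteqP; split => // -[s x] /= []; rewrite in_itv/= => /andP[/lt_le_trans h /h]; rewrite ltxx.
Qed.

Let A := count_integral pp (fun s omega x => enorm2 (f s omega x)).

Lemma good_bracket omega t : finite_set (jump_times pp omega) ->
  A t omega = jump_sum (field_norm2 f) t omega.
Proof. by move=> Jf; rewrite /A (count_integral_jump_sum P B hpt _ _ Jf). Qed.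

Lemma field_norm2_jump_sum omega t : jump_sum (field_norm2 f) t omega =
  \sum_i jump_sum (fun z => field_coord f i z ^+ 2) t omega.
Proof.
rewrite exchange_big; apply: eq_bigr => z _; exact: field_norm2E.
Qed.

(** [W] adds up over the coordinates the nondecreasing functions that control the local errors in
    [compensated_square]. *)
Lemma good_square_sum omega t (pi : nat -> seq R) : good omega -> 0 <= t <= T ->
  (forall k, itv_partition 0 t (pi k)) -> mesh (pi k) @[k --> \oo] --> 0 ->
  square_sum Y (pi k) omega @[k --> \oo] --> A t omega.
Proof.
move=> [rf Yf] tT pit mpi; rewrite (good_bracket _ rf.1).
pose W t := \sum_i (drift (fun z => `|field_coord f i z|) t omega +
  2 * jump_sum (fun z => `|field_coord f i z|) t omega).
have := @square_sum_cvg _ _ _ l Y (fun t => jump_sum (field_norm2 f) t omega) W T t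
  pi omega _ tT pit mpi.
rewrite jump_sum0 subr0 (_ : enorm2 (Y 0 omega) = 0) ?add0r; last first.
  rewrite /enorm2 big1// => i _.
  by rewrite Yf ?lexx ?ltW// /compensated jump_sum0 drift0 subrr expr0n.
apply => e e0.
(* There are finitely many coordinates, so they share a delta. *)
have : \forall delta \near (0 : R)^'+, forall i u v,
    0 <= u -> u <= v -> v <= T -> v - u < delta ->
    `|(compensated (field_coord f i) v omega - compensated (field_coord f i) u omega) ^+ 2 -
    (jump_sum (fun z => field_coord f i z ^+ 2) v omega -
     jump_sum (fun z => field_coord f i z ^+ 2) u omega)| <=
    e * ((drift (fun z => `|field_coord f i z|) v omega + 2 * jump_sum (fun z => `|field_coord f i z|) v omega) -
       (drift (fun z => `|field_coord f i z|) u omega + 2 * jump_sum (fun z => `|field_coord f i z|) u omega)).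
  apply: filter_forall => i.
  have [d1 d10 H] := compensated_square (rf.2 i) e0.
  near=> delta => u v u0 uv vT vu; apply: H => //; apply: (lt_trans vu).
  by near: delta; exact: nbhs_right_lt.
move=> H; near (0 : R)^'+ => delta.
exists delta; first by near: delta; exact: nbhs_right_gt.
move=> u v u0 uv vT vu.
rewrite !field_norm2_jump_sum /enorm2 /W -!sumrB mulr_sumr.
apply: (le_trans (ler_norm_sum _ _ _)); apply: ler_sum => i _.
rewrite !mxE !Yf ?u0 ?(le_trans uv)// ?(le_trans u0)//.
by move: i u v u0 uv vT vu; near: delta.
Unshelve. all: by end_near. Qed.

Lemma measurable_process i t : 0 <= t <= T ->
  measurable_fun setT (fun omega => Y t omega 0 i).
Proof.
move=> /[dup] tT /andP[_ tT']; apply: (measurable_wrt_fun hF tT').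
by have [h _ _] := martingale_process i; exact: h.
Qed.

Lemma itv_partition_mem (t : R) s x : itv_partition 0 t s -> x \in 0 :: s -> 0 <= x <= t.
Proof.
move=> /[dup] ps [_ _]; move=> /(nthP t)[k]; rewrite /= => ks <-.
by rewrite (itv_partition_nth_ge ks ps) (itv_partition_nth_le ks ps).
Qed.

Lemma measurable_square_sum t s : 0 <= t <= T -> itv_partition 0 t s ->
  measurable_fun setT (square_sum Y s).
Proof.
move=> /andP[t0 tT] ps.
have mem x : x \in 0 :: s -> 0 <= x <= T.
  by move=> /(itv_partition_mem ps)/andP[-> xt]; rewrite (le_trans xt).
apply: measurable_funD.
  apply: measurable_sum => i; apply: measurable_funX; apply: measurable_process.
  by apply: mem; rewrite mem_head.
apply: measurable_sum => -[k ks]; apply: measurable_sum => i /=.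
apply: measurable_funX; under eq_fun do rewrite !mxE.
apply: measurable_funB; apply: measurable_process; apply: mem.
  by rewrite inE mem_nth ?orbT.
by rewrite mem_nth//= ltnS ltnW.
Qed.

Lemma bracket_adapted : adapted T F A.
Proof.
move=> t /andP[_ tT].
apply: (ae_measurable_wrt (Y := jump_sum (field_norm2 f) t)).
  by apply: filterS ae_good => omega [[Jf _] _]; rewrite good_bracket.
apply: (jump_sum_wrt hT hpt hnu) => //; apply: measurable_field_norm2 => //.
exact: fL.1.
Qed.

(** The sums of squared increments converge on every good path, for any partitions with vanishing
    mesh; convergence in probability follows. *)
Lemma quadratic_variation_process : is_quadratic_variation P T F Y A.
Proof.
split.
- exact: bracket_adapted.
- apply: filterS ae_good => omega [[Jf _] _].
  have -> : (fun t => A t omega) = step (fset_set (jump_times pp omega))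
      (mark_at omega (field_norm2 f)).
    by apply/funext => t; rewrite good_bracket// jump_sum_step.
  split => t _; first exact: step_right_continuous.
  by apply/cvg_ex; eexists; exact: step_left_limit.
- apply: filterS ae_good => omega [[Jf _] _] s t /andP[s0 st] tT.
  rewrite !good_bracket// !jump_sum_step -subr_ge0 step_increment//.
  apply: sumr_ge0 => r _; rewrite /mark_at; case: (pp omega r) => // x.
  by rewrite field_norm2E sumr_ge0// => i _; exact: sqr_ge0.
- move=> t pi tT pit mpi; apply: ae_cvg_probability.
    move=> k; apply: measurable_funB; first exact: measurable_square_sum (pit k).
    apply: (measurable_wrt_fun hF (proj2 (andP tT))).
    exact: bracket_adapted.
  apply: filterS ae_good => omega gw.
  rewrite -[X in _ --> X](subrr (A t omega)); apply: cvgB; last exact: cvg_cst.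
  exact: good_square_sum.
Qed.

End Process.

(** * Bound on the M1 norm, uniform integrability and square integrability *)

Section ProcessNorms.
Context {R : realType} {dO dX : measure_display} {Omega : measurableType dO}
  {X : measurableType dX} (P : probability Omega R) (d l : nat) (T : R)
  (B : R -> Omega -> 'rV[R]_d) (pp : Omega -> R -> option X)
  (nu : {finite_measure set X -> \bar R}).

Local Notation F := (filtration P B pp).
Local Notation mR := (measurableTypeR R).
Local Notation PP := (predictableType P T B pp).
Local Notation mark := (@mark _ _ _ _ _ P _ T B pp).
Local Notation strip t := (`]0%R, t] `*` setT : set (mR * X)%type).
Local Notation lnu := (@lebesgue_measure R \x nu)%E.
Local Notation jump_sum := (@jump_sum _ _ _ _ _ P _ T B pp).
Local Notation drift := (@drift _ _ _ _ _ P _ T B pp nu).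
Local Notation compensated := (@compensated _ _ _ _ _ P _ T B pp nu).
Local Notation L1_field := (@L1_field _ _ _ _ _ P _ T B pp nu).
Local Notation field_coord := (@field_coord _ _ _ _ _ P _ l T B pp).
Local Notation field_norm2 := (@field_norm2 _ _ _ _ _ P _ l T B pp).
Local Notation field_norm := (@field_norm _ _ _ _ _ P _ l T B pp).

Hypothesis hT : 0 < T.
Hypothesis hpt : point_process pp T.
Hypothesis hF : forall t, t <= T -> F t `<=` measurable.
Hypothesis hnu : compensator P T F pp nu.

Variables (f : R -> Omega -> X -> 'rV[R]_l) (Y : R -> Omega -> 'rV[R]_l).
Hypothesis fL : integrable_field P T B pp nu f.
Hypothesis hY : {ae P, forall omega, forall t, 0 <= t <= T ->
  Y t omega = compensated_integral pp nu f t omega}.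

Local Notation bracket := (count_integral pp (fun s omega x => enorm2 (f s omega x))).

(** Serves twice: to compare the root of the bracket with the sum of |f| over the points, and the
    Euclidean norm with the sum of the absolute coordinates. *)
Lemma sqrt_sum_le (I : Type) (r : seq I) (a : I -> R) : (forall i, 0 <= a i) ->
  Num.sqrt (\sum_(i <- r) a i) <= \sum_(i <- r) Num.sqrt (a i).
Proof.
move=> a0; elim: r => [|i r ih]; first by rewrite !big_nil sqrtr0.
rewrite !big_cons.
have s0 : 0 <= \sum_(j <- r) a j by exact: sumr_ge0.
apply: (@le_trans _ _ (Num.sqrt (a i) + Num.sqrt (\sum_(j <- r) a j))); last by rewrite lerD2l.
rewrite -(@ler_pXn2r _ 2)// ?nnegrE ?addr_ge0 ?sqrtr_ge0//.
rewrite sqrrD !sqr_sqrtr ?addr_ge0// addrAC lerDl.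
by rewrite mulrn_wge0// mulr_ge0 ?sqrtr_ge0.
Qed.

(** Allows [M1norm], defined through a chosen version, to be computed with the explicit bracket. *)
Lemma quadratic_variation_unique (A A' : R -> Omega -> R) :
  is_quadratic_variation P T F Y A -> is_quadratic_variation P T F Y A' ->
  {ae P, forall omega, A T omega = A' T omega}.
Proof.
move=> [aA _ _ qA] [aA' _ _ qA'].
have TT : 0 <= T <= T by rewrite lexx ltW.
have mT := measurable_wrt_fun hF (lexx T).
apply: (@limit_in_probability_unique _ _ _ P
  (fun k => square_sum Y (uniform_partition T k))).
- move=> k; apply: (measurable_square_sum hT hpt hF hnu fL hY TT).
  exact: uniform_partitionP.
- by apply: mT; exact: aA.
- by apply: mT; exact: aA'.
- by apply: qA => //; [move=> k; exact: uniform_partitionP|exact: mesh_uniform_partition_cvg].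
- by apply: qA' => //; [move=> k; exact: uniform_partitionP|exact: mesh_uniform_partition_cvg].
Qed.

Lemma integrable_field_norm : P.-integrable setT (EFin \o drift (field_norm f) T).
Proof. by apply: integrable_drift => //; exact: fL.2. Qed.

Lemma M1norm_le : (M1norm P T F Y <= \int[P]_omega (drift (field_norm f) T omega)%:E)%E.
Proof.
have qA := quadratic_variation_process hT hpt hF hnu fL hY.
have qQ : is_quadratic_variation P T F Y (quadratic_variation P T F Y).
  (* The bracket witnesses that a version exists, so the chosen one is a genuine quadratic
     variation. *)
  by rewrite /quadratic_variation; apply: xgetPex; exists bracket.
have TT : 0 <= T <= T by rewrite lexx ltW.
have mT := measurable_wrt_fun hF (lexx T).
rewrite /M1norm asboolT; last by exists bracket.
have msq (h : Omega -> R) : measurable_fun setT h ->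
    measurable_fun setT (fun omega => (Num.sqrt (h omega))%:E).
  move=> mh; apply/measurable_EFinP; apply: measurableT_comp => //.
  by apply: continuous_measurable_fun; exact: sqrt_continuous.
have mA : measurable_fun setT (bracket T) by case: qA => aA _ _ _; apply: mT; exact: aA.
have mQ : measurable_fun setT (quadratic_variation P T F Y T).
  by case: qQ => aA _ _ _; apply: mT; exact: aA.
rewrite -(expectation_jump_sum hT hpt hF hnu fL.2).
apply: ae_ge0_le_integral => //.
- exact: msq.
- move=> omega _; rewrite lee_fin; apply: sumr_ge0 => z _; exact: field_norm_ge0.
- exact: measurable_int (integrable_jump_sum hT hpt hF hnu fL.2).
apply: filterS2 (ae_good hT hpt hF hnu fL hY) (quadratic_variation_unique qQ qA).
move=> omega [[Jf _] _] -> _; rewrite (good_bracket P B hpt f T Jf) lee_fin.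
have -> : jump_sum (field_norm f) T omega =
    \sum_(z <- points_upto pp T omega) Num.sqrt (field_norm2 f (mark omega z)).
  by apply: eq_bigr => z _; exact: field_normE.
by apply: sqrt_sum_le => z; rewrite field_norm2E sumr_ge0// => i _; exact: sqr_ge0.
Qed.

Lemma M1norm_lty : (M1norm P T F Y < +oo)%E.
Proof.
apply: le_lt_trans M1norm_le _; rewrite ltey_eq.
by rewrite (integrable_fin_num _ integrable_field_norm).
Qed.

Lemma local_martingale_process : local_martingale P T F Y.
Proof.
(* Y is already a martingale, so the constant time T localises it. *)
exists (fun _ _ => T); split => //.
- move=> _; split=> [omega|t /andP[t0 tT]]; first by rewrite lexx ltW.
  have [Tt|tT'] := leP T t.
    by rewrite (_ : [set _ | _] = setT); [exact: filtrationT|apply/seteqP; split].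
  rewrite (_ : [set _ | _] = set0).
    by rewrite -setCT; apply: filtrationC; exact: filtrationT.
  by apply/seteqP; split.
- by apply: aeW => omega; exists 0%N.
move=> _ i; apply: (rmartingale_compensated hT hpt hF hnu (g := field_coord f i)).
  exact: L1_field_coord.
move=> t /[dup] tT /andP[_ tT'].
apply: filterS (ae_good hT hpt hF hnu fL hY) => omega [_ /(_ t i tT)].
by rewrite /component /stopped (min_idPl tT').
Qed.

Lemma in_M1_process : in_M1 P T F Y.
Proof.
split; first exact: (cadlag_process hT hpt hF hnu fL hY).
  exact: local_martingale_process.
exact: M1norm_lty.
Qed.

Definition dominator omega : R := \sum_i
  (jump_sum (fun z => `|field_coord f i z|) T omega +
   drift (fun z => `|field_coord f i z|) T omega).

Lemma integrable_dominator_sum : P.-integrable setT (EFin \o dominator).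
Proof.
rewrite (_ : _ \o _ = fun omega => (\sum_i
  (jump_sum (fun z => `|field_coord f i z|) T omega +
   drift (fun z => `|field_coord f i z|) T omega)%:E)%E); last first.
  by apply/funext => omega; rewrite sumEFin.
apply: integrable_sum => // i _.
by apply: (integrable_dominator hT hpt hF hnu); exact: L1_field_coord.
Qed.

Lemma enorm_le_sum (x : 'rV[R]_l) : enorm x <= \sum_i `|x 0 i|.
Proof.
have -> : \sum_i `|x 0 i| = \sum_i Num.sqrt (x 0 i ^+ 2).
  by apply: eq_bigr => i _; rewrite sqrtr_sqr.
by apply: sqrt_sum_le => i; exact: sqr_ge0.
Qed.

Lemma ae_process_le_dominator : {ae P, forall omega, forall t, 0 <= t <= T ->
  enorm (Y t omega) <= dominator omega}.
Proof.
have : {ae P, forall omega i t, t <= T -> `|compensated (field_coord f i) t omega| <=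
    jump_sum (fun z => `|field_coord f i z|) T omega +
    drift (fun z => `|field_coord f i z|) T omega}.
  apply: filter_forall => i.
  by apply: (ae_compensated_norm hT hF); exact: L1_field_coord.
apply: filterS2 (ae_good hT hpt hF hnu fL hY) => omega [_ Yf] h t /[dup] tT /andP[_ tT'].
apply: (le_trans (enorm_le_sum _)); apply: ler_sum => i _.
by rewrite Yf// h.
Qed.

Lemma measurable_enorm_process t : 0 <= t <= T ->
  measurable_fun setT (fun omega => enorm (Y t omega)).
Proof.
move=> tT; apply: measurableT_comp.
  by apply: continuous_measurable_fun; exact: sqrt_continuous.
apply: measurable_sum => i; apply: measurable_funX.
exact: (measurable_process hT hpt hF hnu fL hY).
Qed.

Let mdom : measurable_fun setT dominator.
Proof. exact/measurable_EFinP/(measurable_int P)/integrable_dominator_sum. Qed.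

Let mtail (h : Omega -> R) c : measurable_fun setT h ->
  measurable [set omega | (c < h omega)%R].
Proof.
move=> mh; rewrite (_ : [set _ | _] = setT `&` h @^-1` `]c, +oo[).
  by apply: mh => //; exact: measurable_itv.
by rewrite setTI; apply/seteqP; split => w /=; rewrite in_itv/= andbT.
Qed.

(** All norms |Y_t| lie below the integrable variable [dominator], so their tails are at most its
    tail expectation over { dominator > c }. This tends to 0 by absolute continuity, as the event
    has probability at most K / c. *)
Lemma uniformly_integrable_process : uniformly_integrable P T Y.
Proof.
pose g c : R := \int[P]_(omega in [set omega | c < dominator omega]) `|dominator omega|.
have supg c : 0 <= c -> (0 <= ereal_sup [set \int[P]_(omega in [set omega | (c < enorm (Y t omega))%R])
    (enorm (Y t omega))%:E | t in `[0%R, T]] <= (g c)%:E)%E.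
  move=> c0; apply/andP; split.
    apply: ereal_sup_ge; exists (\int[P]_(omega in [set omega | (c < enorm (Y 0 omega))%R])
        (enorm (Y 0 omega))%:E)%E; last first.
      by apply: integral_ge0 => omega _; rewrite lee_fin enorm_ge0.
    by exists 0 => //=; rewrite in_itv/= lexx ltW.
  apply: ge_ereal_sup => _ [t /= + <-]; rewrite in_itv/= => tT.
  rewrite /g /Rintegral fineK; last first.
    apply: integrable_fin_num; first exact: mtail.
    apply: (integrableS measurableT) => //; first exact: mtail.
    exact: (integrable_norm integrable_dominator_sum).
  rewrite [leLHS]integral_mkcond [leRHS]integral_mkcond.
  have mY := measurable_enorm_process tT.
  apply: ae_ge0_le_integral => //.
  - by move=> omega _; rewrite patchE; case: ifPn => // _; rewrite lee_fin enorm_ge0.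
  - apply/(measurable_restrictT _ (mtail c mY)); apply: measurable_funTS.
    exact/measurable_EFinP.
  - by move=> omega _; rewrite patchE; case: ifPn => // _; rewrite lee_fin.
  - apply/(measurable_restrictT _ (mtail c mdom)); apply: measurable_funTS.
    by apply/measurable_EFinP; exact: measurableT_comp.
  apply: filterS ae_process_le_dominator => omega /(_ t tT) YD _.
  rewrite !patchE; case: ifPn => [/set_mem/= cY|_].
    by rewrite mem_set/= ?(lt_le_trans cY)// lee_fin (le_trans YD)// ler_norm.
  by case: ifPn => // _; rewrite lee_fin.
have g0 : g c @[c --> +oo] --> 0.
  apply/cvgrPdist_lt => e e0.
  have [delta [d0 dA]] := integral_normr_continuous integrable_dominator_sum e0.
  pose K := fine (\int[P]_omega `|(dominator omega)%:E|)%E.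
  have Kfin : (\int[P]_omega `|(dominator omega)%:E|)%E = K%:E.
    rewrite fineK//; apply: integrable_fin_num => //.
    exact: (integrable_abse integrable_dominator_sum).
  near=> c; rewrite sub0r normrN ger0_norm; last exact: Rintegral_ge0.
  have c0 : 0 < c by near: c; exact: nbhs_pinfty_gt.
  apply: dA; first exact: mtail.
  set D := [set _ | _]; have mD : measurable D by exact: mtail.
  (* Markov's inequality. *)
  have : (c%:E * P D <= K%:E)%E.
    rewrite -Kfin -integral_cst//.
    apply: (@le_trans _ _ (\int[P]_(omega in D) `|(dominator omega)%:E|)%E).
      apply: ge0_le_integral => //.
      - by move=> omega _; rewrite lee_fin ltW.
      - by apply: measurable_funTS; apply/measurable_EFinP; exact: measurableT_comp.
      by move=> omega /ltW cD; rewrite lee_fin (le_trans cD)// ler_norm.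
    apply: ge0_subset_integral => //.
    by apply/measurable_EFinP; exact: measurableT_comp.
  have PDE : P D \is a fin_num by exact: fin_num_measure.
  rewrite -(fineK PDE) -EFinM lee_fin -ler_pdivlMl// => h.
  suff : ((fine (P D))%:E < delta%:E)%E by rewrite (fineK PDE).
  rewrite lte_fin.
  apply: (le_lt_trans h); rewrite ltr_pdivrMl// -ltr_pdivrMr//.
  by near: c; apply: nbhs_pinfty_gt; exact: num_real.
rewrite /uniformly_integrable.
apply: (squeeze_cvge (f := fun=> 0%E) (h := fun c => (g c)%:E)).
- by near=> c; apply: supg; near: c; exact: nbhs_pinfty_ge.
- exact: cvg_cst.
- by apply: cvg_EFin => //; exact: nearW.
Unshelve. all: by end_near. Qed.

(** For a field bounded by K, each coordinate is at most K N + D almost surely, where N is the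
    number of points and D is K times the mass of the strip; a second moment of N is then enough. *)
Lemma square_integrable_process (K : R) :
  (forall s omega x, enorm (f s omega x) <= K) ->
  (\int[P]_omega (jump_sum (cst 1%R) T omega ^+ 2)%:E < +oo)%E ->
  square_integrable_martingale P T F Y.
Proof.
move=> fK c2fin; split.
- exact: (cadlag_process hT hpt hF hnu fL hY).
- exact: (martingale_process hT hpt hF hnu fL hY).
move=> t tT.
have K0 : 0 <= K by exact: le_trans (enorm_ge0 _) (fK 0 point point).
have cK i (z : PP) : `|field_coord f i z| <= K.
  rewrite /field_coord patchE; case: ifPn => _; last by rewrite normr0.
  exact: le_trans (coord_le_enorm _ _) (fK _ _ _).
have sfin := @strip_lty _ _ _ nu T.
pose D := K * fine (lnu (strip T)).
pose N omega := jump_sum (cst 1%R) T omega.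
have domK omega : good P T B pp nu f Y omega -> dominator omega <= l%:R * (K * N omega + D).
  move=> [rf _]; have -> : l%:R * (K * N omega + D) = \sum_(i < l) (K * N omega + D).
    by rewrite sumr_const card_ord mulr_natl.
  apply: ler_sum => i _; apply: lerD.
    rewrite /N /jump_sum mulr_sumr; apply: ler_sum => z _.
    by rewrite mulr1.
  have mS : measurable (strip T) by exact: measurable_strip.
  rewrite /D -Rintegral_cst//; apply: le_Rintegral => //.
    exact: (integrable_norm (rf.2 i)).
  apply/integrableP; split; first exact: measurable_cst.
  by rewrite /= integral_cst// lte_mul_pinfty// lee_fin.
(* The constants come from (x + y)^2 <= 2 x^2 + 2 y^2; the difference of the two sides is (x -
   y)^2. *)
pose a := 2 * (l%:R * K) ^+ 2; pose b := 2 * (l%:R * D) ^+ 2.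
have mN2 : measurable_fun setT (fun omega => (N omega ^+ 2)%:E).
  apply/measurable_EFinP; apply: measurable_funX.
  apply: (measurable_wrt_fun hF (lexx T)).
  by apply: (jump_sum_wrt hT hpt hnu) => //; exact: measurable_cst.
have a0 : 0 <= a by rewrite mulr_ge0// sqr_ge0.
have b0 : 0 <= b by rewrite mulr_ge0// sqr_ge0.
apply: (@le_lt_trans _ _ (\int[P]_omega (a%:E * (N omega ^+ 2)%:E + b%:E))%E).
  apply: ae_ge0_le_integral => //.
  - by move=> omega _; rewrite lee_fin enorm2_ge0.
  - apply/measurable_EFinP; apply: measurable_sum => i; apply: measurable_funX.
    exact: (measurable_process hT hpt hF hnu fL hY).
  - by move=> omega _; rewrite -EFinM -EFinD lee_fin addr_ge0// mulr_ge0// sqr_ge0.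
  - by apply: emeasurable_funD => //; exact: measurable_funeM.
  apply: filterS2 (ae_good hT hpt hF hnu fL hY) ae_process_le_dominator.
  move=> omega /domK gD /(_ t tT) YD _; rewrite -EFinM -EFinD lee_fin.
  have -> : enorm2 (Y t omega) = enorm (Y t omega) ^+ 2.
    by rewrite sqr_sqrtr// enorm2_ge0.
  have h := le_trans YD gD.
  apply: (@le_trans _ _ ((l%:R * (K * N omega + D)) ^+ 2)).
    rewrite ler_sqr// nnegrE; first exact: enorm_ge0.
    exact: le_trans (enorm_ge0 _) h.
  rewrite /a /b -subr_ge0 [leRHS](_ : _ = (l%:R * K * N omega - l%:R * D) ^+ 2).
    exact: sqr_ge0.
  by ring.
rewrite ge0_integralD//; last first.
- exact: measurable_funeM.
- by move=> omega _; rewrite mule_ge0// lee_fin// sqr_ge0.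
rewrite ge0_integralZl//; last by move=> omega _; rewrite lee_fin sqr_ge0.
rewrite integral_cst// lte_add_pinfty//.
  by rewrite lte_mul_pinfty// lee_fin.
by rewrite lte_mul_pinfty// ?lee_fin// -ge0_fin_numE// fin_num_measure.
Qed.

End ProcessNorms.

(** * Second moment of the number of points *)

Section PoissonMoment.
Context {R : realType} {dO dX : measure_display} {Omega : measurableType dO}
  {X : measurableType dX} (P : probability Omega R) (d : nat) (T : R)
  (B : R -> Omega -> 'rV[R]_d) (pp : Omega -> R -> option X)
  (nu : {finite_measure set X -> \bar R}).

Local Notation F := (filtration P B pp).
Local Notation jump_sum := (@jump_sum _ _ _ _ _ P _ T B pp).

Hypothesis hT : 0 < T.
Hypothesis hpp : poisson_point_process P pp T.
Hypothesis hF : forall t, t <= T -> F t `<=` measurable.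
Hypothesis hnu : compensator P T F pp nu.

Let hpt : point_process pp T. Proof. by case: hpp. Qed.

Let C : set (R * X) := `]0, T] `*` setT.

Lemma exp_series_le (x : R) : 0 <= x ->
  (\sum_(0 <= k <oo) (x ^+ k / k`!%:R)%:E <= (expR x)%:E)%E.
Proof.
move=> x0; apply: lime_le.
  by apply: is_cvg_nneseries => k _ _; rewrite lee_fin divr_ge0// exprn_ge0.
apply: nearW => n; rewrite sumEFin lee_fin.
apply: (@nondecreasing_cvgn_le _ (series (exp_coeff x))); last exact: is_cvg_series_exp_coeff.
by apply: nondecreasing_series => k _ _; rewrite /exp_coeff /= divr_ge0// exprn_ge0.
Qed.

Lemma ae_count_size : {ae P, forall omega,
  count_measure pp omega C = (size (points_upto pp T omega))%:R%:E}.
Proof.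
apply: filterS (ae_finite_jumps hpt hnu) => omega Jf.
rewrite count_measureE// /point_measure dirac_seqE sumEFin; congr EFin.
rewrite -sum1_size natr_sum [RHS]big_filter [RHS]big_mkcond/= big_seq [RHS]big_seq.
apply: eq_bigr => z /(points_gt0 (hpt.1 omega).2) zT.
by rewrite (proj2 (andP zT)) indicE mem_set.
Qed.

(* k^2 <= 4^k bounds E N^2 by the exponential series. *)
Lemma jump_count_square_integrable :
  (\int[P]_omega (jump_sum (cst 1%R) T omega ^+ 2)%:E < +oo)%E.
Proof.
have [mfin _] := hnu measurableT.
have mC : measurable C by exact: measurableX.
have mcount : measurable_fun setT (fun omega => count_measure pp omega C).
  exact: (hpt.2 C mC).
have [_ + _] := hpp => /(_ C mC) /=.
set m := (\int[P]_omega count_measure pp omega C)%E in mfin *.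
(* The finite mean selects the branch of the definition that gives the Poisson weights. *)
rewrite (_ : (m == +oo)%E = false); last by apply/negbTE; rewrite lt_eqF.
move=> Pk.
have m0 : 0 <= fine m by apply: fine_ge0; apply: integral_ge0.
pose D k := [set omega | count_measure pp omega C = k%:R%:E].
have mD k : measurable (D k).
  rewrite (_ : D k = setT `&` (fun omega => count_measure pp omega C) @^-1` [set k%:R%:E]).
    by apply: mcount => //; exact: emeasurable_set1.
  by rewrite setTI.
(* Almost surely N^2 is the term k = N of the series of the nonnegative functions [g k]. *)
pose g (k : nat) omega : \bar R := ((k%:R ^+ 2)%:E * (\1_(D k) omega)%:E)%E.
have mg k : measurable_fun setT (g k).
  by apply: measurable_funeM; apply/measurable_EFinP; exact: measurable_indic.
have g0 k omega : (0 <= g k omega)%E by rewrite mule_ge0// lee_fin// sqr_ge0.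
apply: (@le_lt_trans _ _ (\int[P]_omega \sum_(0 <= k <oo) g k omega)%E).
  apply: ae_ge0_le_integral => //.
  - by move=> omega _; rewrite lee_fin sqr_ge0.
  - apply/measurable_EFinP; apply: measurable_funX.
    apply: (measurable_wrt_fun hF (lexx T)).
    by apply: (jump_sum_wrt hT hpt hnu) => //; exact: measurable_cst.
  - by move=> omega _; apply: nneseries_ge0 => k _ _; exact: g0.
  - by apply: ge0_emeasurable_sum => // k _; exact: mg.
  apply: filterS ae_count_size => omega cn _.
  set n := size _ in cn.
  have -> : jump_sum (cst 1%R) T omega = n%:R.
    by rewrite /jump_sum /n -sum1_size natr_sum.
  have -> : ((n%:R : R) ^+ 2)%:E = g n omega.
    by rewrite /g indicE mem_set// mule1.
  apply: (@le_trans _ _ (\sum_(0 <= k < n.+1) g k omega)%E); last first.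
    exact: nneseries_lim_ge.
  by rewrite big_nat_recr//= leeDr// sume_ge0.
rewrite integral_nneseries//.
(* Term by term, k^2 e^(-m) m^k / k! <= (4 m)^k / k!, with e^(-m) <= 1. *)
apply: (@le_lt_trans _ _ (expR (4 * fine m))%:E); last exact: ltry.
apply: le_trans (exp_series_le _); last by rewrite mulr_ge0.
apply: lee_nneseries => [k _ _|k _]; first by apply: integral_ge0.
rewrite ge0_integralZl//; last first.
  by apply/measurable_EFinP; exact: measurable_indic.
have -> : (\int[P]_x (\1_(D k) x)%:E)%E = P (D k) by rewrite integral_indic// setIT.
rewrite [P (D k)]Pk -EFinM lee_fin.
rewrite exprMn -[X in X <= _]mulrA [X in X <= _](_ : _ =
  k%:R ^+ 2 * expR (- fine m) * (fine m ^+ k / k`!%:R)); last by ring.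
rewrite -[leRHS]mulrA ler_wpM2r ?divr_ge0 ?exprn_ge0//.
apply: (@le_trans _ _ (k%:R ^+ 2)).
  by rewrite ler_piMr ?sqr_ge0// -expR0 ler_expR oppr_le0.
rewrite (_ : 4 = 2 ^+ 2 :> R); last by rewrite -natrX.
rewrite -exprM mulnC exprM ler_sqr ?nnegrE ?exprn_ge0//.
by rewrite -natrX ler_nat ltnW// ltn_expl.
Qed.

End PoissonMoment.

(** * Truncation and linearity *)

Section FieldOperations.
Context {R : realType} {dO dX : measure_display} {Omega : measurableType dO}
  {X : measurableType dX} (P : probability Omega R) (d l : nat) (T : R)
  (B : R -> Omega -> 'rV[R]_d) (pp : Omega -> R -> option X)
  (nu : {finite_measure set X -> \bar R}).

Local Notation F := (filtration P B pp).
Local Notation mR := (measurableTypeR R).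
Local Notation PP := (predictableType P T B pp).
Local Notation mark := (@mark _ _ _ _ _ P _ T B pp).
Local Notation strip t := (`]0%R, t] `*` setT : set (mR * X)%type).
Local Notation lnu := (@lebesgue_measure R \x nu)%E.
Local Notation jump_sum := (@jump_sum _ _ _ _ _ P _ T B pp).
Local Notation drift := (@drift _ _ _ _ _ P _ T B pp nu).
Local Notation compensated := (@compensated _ _ _ _ _ P _ T B pp nu).
Local Notation L1_field := (@L1_field _ _ _ _ _ P _ T B pp nu).
Local Notation field_coord := (@field_coord _ _ _ _ _ P _ l T B pp).
Local Notation field_norm := (@field_norm _ _ _ _ _ P _ l T B pp).
Local Notation measurable_field := (@measurable_field _ _ _ _ _ P _ l T B pp).
Local Notation integrable_field := (@integrable_field _ _ _ _ _ P _ l T B pp nu).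
Local Notation regular := (@regular _ _ _ _ _ P _ l T B pp nu).

Hypothesis hT : 0 < T.
Hypothesis hpt : point_process pp T.
Hypothesis hF : forall t, t <= T -> F t `<=` measurable.

Implicit Types f g : R -> Omega -> X -> 'rV[R]_l.

Lemma L1_field_cst (c : R) : L1_field (cst c).
Proof.
split; first exact: measurable_cst.
have -> : (\int[P]_omega \int[lnu]_(z in strip T) `|(cst c (mark omega z))%:E| =
    \int[P]_omega (`|c|%:E * lnu (strip T)))%E.
  apply: eq_integral => omega _.
  by rewrite -integral_cst//; exact: measurable_strip.
rewrite integral_cst// [X in (_ * X)%E](@probability_setT _ _ _ P) mule1 lte_mul_pinfty//.
exact: strip_lty.
Qed.

Lemma L1_fieldD (g h : PP -> R) : L1_field g -> L1_field h -> L1_field (g \+ h).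
Proof.
move=> /(L1_fieldP nu hT hF) gL /(L1_fieldP nu hT hF) hL; apply/(L1_fieldP nu hT hF).
exact: integrableD gL hL.
Qed.

(** For p >= 1, |x| <= 1 + |x|^p: the second term is an L1 field by assumption, the first because
    the strip has finite mass. *)
Lemma integrable_field_Up p f : 1 <= p -> in_Up P T F nu p f -> integrable_field f.
Proof.
move=> p1 [pf fp]; have mf := predictable_measurable_field hT pf.
split=> //; have mn := measurable_field_norm mf.
pose hp (z : PP) := field_norm f z `^ p.
have mhp : measurable_fun setT hp.
  exact: (measurableT_comp (measurable_powR p) mn).
have hp0 z : 0 <= hp z by exact: powR_ge0.
have hpL : L1_field hp.
  split => //; apply: le_lt_trans fp; rewrite le_eqVlt; apply/orP; left; apply/eqP.
  apply: eq_integral => omega _.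
  have mphi : measurable_fun setT (fun z => `|(hp (mark omega z))%:E|)%E.
    apply: measurableT_comp => //; apply/measurable_EFinP.
    exact: measurable_comp_mark.
  rewrite -ge0_integral_strip//.
  have E s : s \in `]0, T] -> (\int[nu]_x `|(hp (mark omega (s, x)))%:E| =
      \int[nu]_x (enorm (f s omega x) `^ p)%:E)%E.
    rewrite in_itv/= => sT; apply: eq_integral => x _.
    rewrite ger0_norm// /hp /field_norm.
    by rewrite (field_patchE _ _ _ (fun s w x => enorm (f s w x))).
  (* Dropping the time 0 from [0, T] requires the inner integral to be measurable in time, which
     Tonelli provides through the cut-off field. *)
  rewrite -integral_itv_obnd_cbnd; first by apply: eq_integral => s /set_mem; exact: E.
  apply: (eq_measurable_fun (fun s => \int[nu]_x `|(hp (mark omega (s, x)))%:E|)%E).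
    by move=> s /set_mem/= sT; rewrite E.
  apply: measurable_funTS.
  exact: (measurable_fun_fubini_tonelli_F (m2 := nu) _ mphi (fun=> abse_ge0 _)).
apply: (L1_field_le hT hF mn _ (L1_fieldD (L1_field_cst 1) hpL)) => z.
have n0 := field_norm_ge0 f z.
rewrite /= !ger0_norm ?addr_ge0//.
have [n1|n1] := leP (field_norm f z) 1; first by rewrite (le_trans n1)// lerDl.
apply: (@le_trans _ _ (hp z)); last by rewrite lerDr.
by rewrite -[leLHS]powRr1// ler_powR// ltW.
Qed.

Lemma field_norm_le f g (z : PP) :
  (forall s omega x, enorm (f s omega x) <= enorm (g s omega x)) ->
  field_norm f z <= field_norm g z.
Proof. by move=> fg; rewrite /field_norm !patchE; case: ifP. Qed.

Lemma integrable_field_le f g : measurable_field f ->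
  (forall s omega x, enorm (f s omega x) <= enorm (g s omega x)) ->
  integrable_field g -> integrable_field f.
Proof.
move=> mf fg [mg gL]; split; first exact: mf.
apply: (L1_field_le hT hF (measurable_field_norm mf) _ gL) => z.
by rewrite !ger0_norm ?field_norm_ge0//; exact: field_norm_le.
Qed.

Lemma field_coord_lin (a : R) f g i (z : PP) :
  field_coord (fun s omega x => a *: f s omega x + g s omega x) i z =
  a * field_coord f i z + field_coord g i z.
Proof.
rewrite /field_coord !patchE; case: ifP => _; first by rewrite !mxE.
by rewrite mulr0 addr0.
Qed.

Lemma measurable_field_lin (a : R) f g : measurable_field f -> measurable_field g ->
  measurable_field (fun s omega x => a *: f s omega x + g s omega x).
Proof.
move=> mf mg i; rewrite (_ : field_coord _ i =
    (fun z => a * field_coord f i z + field_coord g i z)); last first.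
  by apply/funext => z; exact: field_coord_lin.
by apply: measurable_funD; [apply: measurable_funM|exact: mg].
Qed.

Lemma measurable_field_truncate n f : measurable_field f ->
  measurable_field (truncate n f).
Proof.
move=> mf i; rewrite (_ : field_coord _ i =
    (fun z => if field_norm f z <= n%:R then field_coord f i z else 0)); last first.
  apply/funext => z; rewrite /field_coord /field_norm !patchE /truncate.
  by case: ifPn => _; case: ifPn; rewrite ?mxE.
apply: measurable_fun_ifT => //.
by apply: measurable_fun_ler => //; exact: measurable_field_norm.
Qed.

Lemma regular_lin (a : R) f g omega : regular f omega -> regular g omega ->
  regular (fun s omega x => a *: f s omega x + g s omega x) omega.
Proof.
move=> [Jf rf] [_ rg]; split => // i; have ms : measurable (strip T) by exact: measurable_strip.
have := integrableD ms (integrableZl ms a (rf i)) (rg i).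
congr (_.-integrable _ _); apply/funext => z.
by rewrite field_coord_lin EFinD EFinM.
Qed.

(** An identity on each path regular for both fields; the almost sure linearity of the integral
    follows. *)
Lemma compensated_integral_lin (a : R) f g t omega :
  measurable_field f -> measurable_field g -> regular f omega -> regular g omega ->
  0 <= t <= T ->
  compensated_integral pp nu (fun s omega x => a *: f s omega x + g s omega x) t omega =
  a *: compensated_integral pp nu f t omega + compensated_integral pp nu g t omega.
Proof.
move=> mf mg rf rg /[dup] tT' /andP[t0 tT]; apply/rowP => i.
have lin (u v w : 'rV[R]_l) : u 0 i = a * v 0 i + w 0 i -> u 0 i = (a *: v + w) 0 i.
  by move=> ->; rewrite !mxE.
apply: lin.
rewrite [X in a * X + _](compensated_integralE hpt i mf rf tT').
rewrite [X in _ + X](compensated_integralE hpt i mg rg tT').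
rewrite [LHS](compensated_integralE hpt i (measurable_field_lin a mf mg) (regular_lin a rf rg) tT').
rewrite /compensated mulrBr addrACA -opprD; congr (_ - _).
  rewrite /jump_sum mulr_sumr -big_split/=; apply: eq_bigr => z _.
  exact: field_coord_lin.
have ms u : measurable (strip u) by exact: measurable_strip.
have subT : strip t `<=` strip T.
  by move=> -[r x] /=; rewrite !in_itv/= => -[/andP[-> rt] _]; rewrite (le_trans rt).
have it h : regular h omega ->
    lnu.-integrable (strip t) (EFin \o (field_coord h i \o mark omega)).
  by move=> [_ rh]; exact: (integrableS (ms _) (ms _) subT (rh i)).
rewrite /drift -RintegralZl ?it// -RintegralD ?it//; last first.
  by have := integrableZl (ms t) a (it f rf); congr (_.-integrable _ _).
by congr fine; apply: eq_integral => z _; rewrite /= field_coord_lin.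
Qed.

End FieldOperations.

(** * Convergence of the truncated integrals in M1 *)

Section TruncationLimit.
Context {R : realType} {dO dX : measure_display} {Omega : measurableType dO}
  {X : measurableType dX} (P : probability Omega R) (d l : nat) (T : R)
  (B : R -> Omega -> 'rV[R]_d) (pp : Omega -> R -> option X)
  (nu : {finite_measure set X -> \bar R}).

Local Notation F := (filtration P B pp).
Local Notation PP := (predictableType P T B pp).
Local Notation drift := (@drift _ _ _ _ _ P _ T B pp nu).
Local Notation L1_field := (@L1_field _ _ _ _ _ P _ T B pp nu).
Local Notation field_norm := (@field_norm _ _ _ _ _ P _ l T B pp).
Local Notation integrable_field := (@integrable_field _ _ _ _ _ P _ l T B pp nu).

Hypothesis hT : 0 < T.
Hypothesis hpt : point_process pp T.
Hypothesis hF : forall t, t <= T -> F t `<=` measurable.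
Hypothesis hnu : compensator P T F pp nu.

Let mdriftT := @mdrift _ _ _ _ _ P _ T B pp nu hT hF T (lexx T).

Lemma enorm0 : enorm (0 : 'rV[R]_l) = 0.
Proof.
by rewrite /enorm /enorm2 big1 ?sqrtr0// => i _; rewrite mxE expr0n.
Qed.

Lemma enormN (x : 'rV[R]_l) : enorm (- x) = enorm x.
Proof.
by congr Num.sqrt; apply: eq_bigr => i _; rewrite mxE sqrrN.
Qed.

(** Rewrites the expected drift as an integral against one measure, where monotonicity and dominated
    convergence apply directly. *)
Lemma expectation_drift g : L1_field g ->
  (\int[P]_omega (drift g T omega)%:E = \int[mixture P mdriftT]_z (g z)%:E)%E.
Proof.
move=> gL; have [mg _] := gL; have gi := L1_field_integrable hT hF gL.
rewrite integral_mixture// -(integrable_fine_ae (integrable_mixture gi)).2.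
by apply: eq_integral => omega _; rewrite driftE.
Qed.

(** The difference of the integrals is almost surely the integral of f - g, to which [M1norm_le]
    applies. The field f - g is written in the form required by [compensated_integral_lin]. *)
Lemma M1dist_le (f g : R -> Omega -> X -> 'rV[R]_l) (h : PP -> R) :
  integrable_field f -> integrable_field g -> L1_field h ->
  (forall z, field_norm (fun s omega x => -1 *: g s omega x + f s omega x) z <= h z) ->
  (M1dist P T F (compensated_integral pp nu f) (compensated_integral pp nu g) <=
   \int[P]_omega (drift h T omega)%:E)%E.
Proof.
move=> fL gL hL fgh.
have mfg := measurable_field_lin (-1) gL.1 fL.1.
have fgL : L1_field (field_norm (fun s omega x => -1 *: g s omega x + f s omega x)).
  apply: (L1_field_le hT hF (measurable_field_norm mfg) _ hL) => z.
  by rewrite ger0_norm ?field_norm_ge0// (le_trans (fgh z))// ler_norm.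
apply: (le_trans (M1norm_le hT hpt hF hnu (conj mfg fgL) _)).
  apply: filterS2 (ae_regular hT hpt hF hnu fL) (ae_regular hT hpt hF hnu gL).
  move=> omega rf rg t tT; rewrite (compensated_integral_lin hpt (-1) gL.1 fL.1 rg rf tT).
  by rewrite scaleN1r addrC.
rewrite !expectation_drift//; apply: ge0_le_integral => //.
- by move=> z _; rewrite lee_fin field_norm_ge0.
- by apply/measurable_EFinP; exact: measurable_field_norm.
- by apply/measurable_EFinP; exact: hL.1.
- by move=> z _; rewrite lee_fin.
Qed.

Variable U : R -> Omega -> X -> 'rV[R]_l.
Hypothesis UL : integrable_field U.

Definition norm_tail (n : nat) (z : PP) : R :=
  if field_norm U z <= n%:R then 0 else field_norm U z.

Lemma L1_norm_tail n : L1_field (norm_tail n).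
Proof.
have mU := measurable_field_norm UL.1.
apply: (L1_field_le hT hF _ _ UL.2) => [|z]; last first.
  by rewrite /norm_tail; case: ifP; rewrite ?normr0.
by apply: measurable_fun_ifT => //; exact: measurable_fun_ler.
Qed.

Lemma norm_tail_cvg0 :
  (\int[P]_omega (drift (norm_tail n) T omega)%:E @[n --> \oo] --> 0)%E.
Proof.
have mU := measurable_field_norm UL.1.
have [] := @dominated_convergence _ _ _ (mixture P mdriftT) setT measurableT
  (fun n z => (norm_tail n z)%:E) (cst 0%E) (EFin \o field_norm U).
- by move=> n; apply/measurable_EFinP; exact: (L1_norm_tail n).1.
- exact: measurable_cst.
- apply: aeW => z _; apply: cvg_near_cst; near=> n.
  rewrite /norm_tail ifT//; near: n; exact: nbhs_infty_ger.
- exact: L1_field_integrable UL.2.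
- apply: aeW => z n _; rewrite lee_fin /norm_tail.
  by case: ifP => _; rewrite ?normr0 ?ger0_norm ?field_norm_ge0.
move=> _ _; rewrite integral0; apply: cvg_trans; apply: near_eq_cvg.
by apply: nearW => n; rewrite expectation_drift//; exact: L1_norm_tail.
Unshelve. all: by end_near. Qed.

Lemma integrable_field_truncate n : integrable_field (truncate n U).
Proof.
apply: (integrable_field_le hT hF _ _ UL).
  exact: measurable_field_truncate UL.1.
move=> s omega x; rewrite /truncate; case: ifP => // _.
by rewrite enorm0 enorm_ge0.
Qed.

Lemma enorm_truncate_le n s omega x : enorm (truncate n U s omega x) <= n%:R.
Proof.
rewrite /truncate; case: ifPn => // _.
by rewrite enorm0 ler0n.
Qed.

(** A common criterion for the Cauchy property and for convergence: the difference field either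
    vanishes or has the norm of U at a point where |U| > n. *)
Lemma norm_tail_ge (f : R -> Omega -> X -> 'rV[R]_l) n z :
  (forall s omega x, f s omega x = 0 \/
     ~~ (enorm (U s omega x) <= n%:R) /\ enorm (f s omega x) = enorm (U s omega x)) ->
  field_norm f z <= norm_tail n z.
Proof.
move=> fU; rewrite /norm_tail /field_norm !patchE; case: ifPn => _.
  have [->|[/negbTE-> ->//]] := fU z.1.1 z.1.2 z.2.
  by rewrite enorm0; case: ifP => // _; exact: enorm_ge0.
by rewrite ler0n.
Qed.

Lemma M1dist_truncate_le k m n : (k <= m)%N -> (k <= n)%N ->
  (M1dist P T F (compensated_integral pp nu (truncate m U))
     (compensated_integral pp nu (truncate n U)) <=
   \int[P]_omega (drift (norm_tail k) T omega)%:E)%E.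
Proof.
move=> km kn; apply: M1dist_le; [exact: integrable_field_truncate..|exact: L1_norm_tail|].
move=> z; apply: norm_tail_ge => s omega x; rewrite scaleN1r /truncate.
have le_k (j : nat) : (k <= j)%N -> enorm (U s omega x) <= k%:R -> enorm (U s omega x) <= j%:R.
  by move=> kj Uk; rewrite (le_trans Uk)// ler_nat.
(* Where |U| <= k both truncations equal U and cancel; elsewhere their difference is 0, U or -U. *)
have [Uk|Uk] := boolP (enorm (U s omega x) <= k%:R).
  by left; rewrite (le_k _ km Uk) (le_k _ kn Uk) addNr.
case: ifPn => Un; case: ifPn => Um; rewrite ?oppr0 ?addr0 ?add0r ?addNr.
- by left.
- by right; rewrite enormN.
- by right.
- by left.
Qed.

Lemma M1dist_truncate_limit_le n :
  (M1dist P T F (compensated_integral pp nu (truncate n U))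
     (compensated_integral pp nu U) <=
   \int[P]_omega (drift (norm_tail n) T omega)%:E)%E.
Proof.
apply: M1dist_le; [exact: integrable_field_truncate|exact: UL|exact: L1_norm_tail|].
move=> z; apply: norm_tail_ge => s omega x; rewrite scaleN1r /truncate.
by case: ifPn => Un; [left; rewrite addNr|right; rewrite addr0 enormN].
Qed.

Lemma M1norm_ge0 (Y : R -> Omega -> 'rV[R]_l) : (0 <= M1norm P T F Y)%E.
Proof.
rewrite /M1norm; case: ifP => // _; apply: integral_ge0 => omega _.
by rewrite lee_fin sqrtr_ge0.
Qed.

Lemma in_M1_truncate n : in_M1 P T F (compensated_integral pp nu (truncate n U)).
Proof.
apply: (in_M1_process hT hpt hF hnu (integrable_field_truncate n)).
exact: aeW.
Qed.

Lemma M1_cauchy_truncate :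
  M1_cauchy P T F (fun n => compensated_integral pp nu (truncate n U)).
Proof.
split=> [n|eps eps0]; first exact: in_M1_truncate.
have /norm_tail_cvg0[n0 _ n0P] : nbhs 0%E [set y : \bar R | (y < eps%:E)%E].
  by apply: open_nbhs_nbhs; split; [exact: open_ereal_lt_ereal|rewrite /= lte_fin].
exists n0 => m n n0m n0n; apply: le_lt_trans (M1dist_truncate_le n0m n0n) _.
exact: n0P (leqnn _).
Qed.

Lemma M1_converges_truncate :
  M1_converges P T F (fun n => compensated_integral pp nu (truncate n U))
    (compensated_integral pp nu U).
Proof.
split; first by apply: (in_M1_process hT hpt hF hnu UL); exact: aeW.
apply: (squeeze_cvge (f := fun=> 0%E)); last exact: norm_tail_cvg0.
- by apply: nearW => n; rewrite M1norm_ge0 M1dist_truncate_limit_le.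
- exact: cvg_cst.
Qed.

End TruncationLimit.

Theorem lemma1p1 (R : realType) (T : R) (l d : nat)
  (dO : measure_display) (Omega : measurableType dO) (P : probability Omega R)
  (dX : measure_display) (X : measurableType dX)
  (nu : {finite_measure set X -> \bar R})
  (B : R -> Omega -> 'rV[R]_d) (pp : Omega -> R -> option X) (p : R)
  (hT : 0 < T) (hl : (0 < l)%N) (hd : (0 < d)%N)
  (hcomplete : measure_is_complete P)
  (hB : brownian_motion P T B)
  (hpp : poisson_point_process P pp T)
  (hindep : independent_families P (brownian_sigma T B)
              (point_process_sigma pp))
  (hnu : compensator P T (filtration P B pp) pp nu)
  (hp : 1 <= p < 2) :
  let F := filtration P B pp in
  let MUn (U : R -> Omega -> X -> 'rV[R]_l) (n : nat) :=
    compensated_integral pp nu (truncate n U) in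
  exists M : (R -> Omega -> X -> 'rV[R]_l) -> R -> Omega -> 'rV[R]_l,
    (forall U, in_Up P T F nu p U ->
       [/\ forall n, square_integrable_martingale P T F (MUn U n),
           M1_cauchy P T F (MUn U) &
           M1_converges P T F (MUn U) (M U)] /\
       [/\ [/\ cadlag P T (M U), martingale P T F (M U) &
               uniformly_integrable P T (M U)],
           is_quadratic_variation P T F (M U)
             (count_integral pp (fun s omega x => enorm2 (U s omega x))) &
           {ae P, forall omega, forall t, 0 < t <= T ->
              path_jump (fun s => M U s omega) t =
              at_jump pp U t omega}]) /\
    (forall (a : R) U V, in_Up P T F nu p U -> in_Up P T F nu p V ->
       indistinguishable P T
         (M (fun s omega x => a *: U s omega x + V s omega x))
         (fun s omega => a *: M U s omega + M V s omega)).
Proof.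
move=> F MUn; have [[hpt _ _] [mB _ _ _ _]] := (hpp, hB).
(* By completeness the null sets added to the filtration are events. *)
have hF t : t <= T -> F t `<=` measurable.
  exact: (filtration_measurable hcomplete (fun s i => mB s i) hpt.2).
have UpL (U : R -> Omega -> X -> 'rV[R]_l) : in_Up P T F nu p U -> integrable_field P T B pp nu U.
  by apply: (integrable_field_Up hT hF); case/andP: hp.
exists (fun U => compensated_integral pp nu U); split => [U UUp|a U V UUp VUp].
  have UL := UpL _ UUp.
  have ae_refl (f : R -> Omega -> X -> 'rV[R]_l) : {ae P, forall omega, forall t, 0 <= t <= T ->
      compensated_integral pp nu f t omega = compensated_integral pp nu f t omega}.
    exact: aeW.
  split; split.
  (* The truncated field is bounded by n, and the Poisson law supplies the second moment of the
     number of points. *)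
  - move=> n; apply: (square_integrable_process hT hpt hF hnu
      (integrable_field_truncate hT hF UL n) (ae_refl _) (K := n%:R)).
      exact: enorm_truncate_le.
    exact: (jump_count_square_integrable hT hpp hF hnu).
  - exact: (M1_cauchy_truncate hT hpt hF hnu UL).
  - exact: (M1_converges_truncate hT hpt hF hnu UL).
  - split.
    + exact: (cadlag_process hT hpt hF hnu UL (ae_refl _)).
    + exact: (martingale_process hT hpt hF hnu UL (ae_refl _)).
    + exact: (uniformly_integrable_process hT hpt hF hnu UL (ae_refl _)).
  - exact: (quadratic_variation_process hT hpt hF hnu UL (ae_refl _)).
  - exact: (jump_process hT hpt hF hnu UL (ae_refl _)).
have [UL VL] := (UpL _ UUp, UpL _ VUp).
apply: filterS2 (ae_regular hT hpt hF hnu UL) (ae_regular hT hpt hF hnu VL).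
by move=> omega rU rV t tT; exact: compensated_integral_lin UL.1 VL.1 rU rV tT.
Qed.
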